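(* Let $\Omega\subseteq\mathbb{R}^n$ be open with $\Omega\cap\Sigma\neq\emptyset$, let $K\Subset\Omega$ be compact and $m\in\mathbb{Z}$. For each multi-index $\alpha\in\mathbb{N}^{n}$ (entries non-negative integers), the partial differential operator maps $$\left(\frac{\partial}{\partial x}\right)^{\alpha}:\ \mathcal{D}^{[m;K]}_{\ast,\Sigma}(\Omega)\to\mathcal{D}^{[m-|\alpha|;K]}_{\ast,\Sigma}(\Omega).$$
   Context: $\Sigma\subset\mathbb{R}^n$ is a (boundaryless) closed smooth submanifold of codimension $d\geq 1$, not assumed orientable; $N_\xi(\Sigma)$ is its normal space at $\xi\in\Sigma$. Fix a continuous $\epsilon:\Sigma\to(0,\infty)$ such that on the open set $\Sigma^{\epsilon}=\{x\in\mathbb{R}^n:\ \|x-\xi\|<\epsilon(\xi)\text{ for some }\xi\in\Sigma\}$ every $x$ has a unique closest point $\pi(x)\in\Sigma$ and $\pi:\Sigma^\epsilon\to\Sigma$ is a smooth submersion (tubular neighborhood theorem). Fix a family $\{U_\nu\}_{\nu\in\mathbb{N}}$ of bounded open subsets of $\Sigma^{\epsilon}$ such that $\{\Sigma\cap U_\nu\}_\nu$ is an open covering of $\Sigma$ and, for each $\nu$: (i) $U_\nu\cap\Sigma\neq\emptyset$; (ii) there are smooth vector fields $\mathbf{n}^\nu_j:U_\nu\cap\Sigma\to\mathbb{S}^{n-1}$, $j=1,\dots,d$, forming an orthonormal basis of $N_\xi(\Sigma)$ at each $\xi\in U_\nu\cap\Sigma$; (iii) there is $\rho_\nu>0$ such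 that $(\xi,\omega,\rho)\mapsto\xi+\rho\sum_{j=1}^d\omega_j\mathbf{n}^\nu_j(\xi)$ is a diffeomorphism from $(\Sigma\cap U_\nu)\times\mathbb{S}^{d-1}\times(0,\rho_\nu)$ onto $U_\nu\setminus\Sigma$. For $x\in U_\nu\setminus\Sigma$, $(\xi_x,\omega_x,\rho_x)$ denotes the image of $x$ under the inverse of this diffeomorphism; explicitly $\xi_x=\pi(x)$, $\rho_x=\|x-\pi(x)\|$, $\omega_{x,k}=\mathbf{n}^\nu_k(\pi(x))\cdot(x-\pi(x))/\|x-\pi(x)\|$. $K\Subset\Omega$ means that $K$ is a compact subset of the interior of $\Omega$. An asymptotic expansion $b(x)\sim\sum_j c_j(x)$ of smooth functions is called strong if it may be differentiated termwise: for each multi-index $\alpha$, $\partial^\alpha b\sim\sum_j\partial^\alpha c_j$ (here: for each $\alpha$ and each $q$, for all sufficiently large $N$ the difference of $\partial^\alpha b$ and $\sum_{j\le N}\partial^\alpha c_j$ is $O(\rho_x^q)$ as $\rho_x\to0$, uniformly). For $\Omega\subseteq\mathbb{R}^n$ open with $\Omega\cap\Sigma\ne\emptyset$, $\mathcal{D}^{[m;K]}_{\ast,\Sigma}(\Omega)$ is the space of all $\phi\in C^\infty(\Omega\setminus\Sigma)$ vanishing outside $K$ such that on each nonempty $\Omega\cap U_\nu\setminus\Sigma$ the function $\phi$ admits a (uniform) strong asymptotic expansion $\phi(x)\sim\sum_{j=m}^\infty a_j(\xi_x,\omega_x)\rho_x^j$ as $\rho_x\to0$, with some $a_j=a_j^{\phi,\nu}\in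 C^\infty((\Sigma\cap U_\nu)\times\mathbb{S}^{d-1})$. *)

(* Defs.v *)
From HB Require Import structures.
From mathcomp Require Import all_boot all_order all_algebra.
From mathcomp Require Import all_classical all_reals all_analysis.
Set Implicit Arguments.
Unset Strict Implicit.
Unset Printing Implicit Defensive.
Import Order.TTheory GRing.Theory Num.Theory.
Import numFieldNormedType.Exports.
Local Open Scope classical_set_scope.
Local Open Scope ring_scope.

(* The library norm on row vectors is the sup norm; it induces the usual
   topology, but distances and spheres below are Euclidean. *)
Definition dot (R : realType) (n : nat) (x y : 'rV[R]_n) : R :=
  \sum_(i < n) x 0 i * y 0 i.

Definition enorm (R : realType) (n : nat) (x : 'rV[R]_n) : R :=
  Num.sqrt (dot x x).

Definition sphere (R : realType) (d : nat) : set 'rV[R]_d :=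
  [set w | enorm w = 1].

(* C^k on an open set: differentiable with derivative of class C^(k-1).
   The derivative is tested on each vector v, which in finite dimension is the
   same as using the topology of the space of linear maps. *)
Fixpoint Ck (R : realType) (V W : normedModType R) (k : nat) (O : set V)
    (f : V -> W) : Prop :=
  if k is k'.+1 then
    (forall x, O x -> differentiable f x) /\
    (forall v, Ck k' O (fun x => 'd f x v))
  else forall x, O x -> {for x, continuous f}.

Definition smooth_open (R : realType) (V W : normedModType R) (O : set V)
    (f : V -> W) : Prop := forall k, Ck k O f.

(* Smoothness on an arbitrary subset A (in practice a submanifold): existence of
   local smooth extensions to the ambient space. *)
Definition smooth_on (R : realType) (V W : normedModType R) (A : set V)
    (f : V -> W) : Prop :=
  forall x, A x -> exists (O : set V) (F : V -> W),
    [/\ open O, O x, smooth_open O F & forall y, O y -> A y -> F y = f y].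

(* f is a diffeomorphism from A onto B with inverse g. *)
Definition diffeo (R : realType) (V W : normedModType R) (A : set V) (B : set W)
    (f : V -> W) (g : W -> V) : Prop :=
  [/\ smooth_on A f, smooth_on B g,
      (forall x, A x -> B (f x) /\ g (f x) = x) &
      (forall y, B y -> A (g y) /\ f (g y) = y)].

(* A boundaryless smooth submanifold of R^n of codimension d, closed as a subset:
   locally it is straightened to the vanishing of the last d coordinates. *)
Definition closed_submanifold (R : realType) (n d : nat)
    (Sigma : set 'rV[R]_n) : Prop :=
  [/\ (d <= n)%N, closed Sigma &
   forall xi, Sigma xi -> exists (O O' : set 'rV[R]_n) (psi psi' : 'rV[R]_n -> 'rV[R]_n),
     [/\ open O, O xi, open O', diffeo O O' psi psi' &
      forall x, O x ->
        (Sigma x <-> forall i : 'I_n, (n - d <= i)%N -> psi x 0 i = 0)]].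

(* Velocities at xi of smooth curves in Sigma. *)
Definition tangent_space (R : realType) (n : nat) (Sigma : set 'rV[R]_n)
    (xi : 'rV[R]_n) : set 'rV[R]_n :=
  [set v | exists (gamma : R -> 'rV[R]_n) (e : R),
     [/\ 0 < e, smooth_open `]- e, e[ gamma,
         forall t, t \in `]- e, e[ -> Sigma (gamma t),
         gamma 0 = xi & derive1 gamma 0 = v]].

Definition normal_space (R : realType) (n : nat) (Sigma : set 'rV[R]_n)
    (xi : 'rV[R]_n) : set 'rV[R]_n :=
  [set w | forall v, tangent_space Sigma xi v -> dot w v = 0].

Definition tube (R : realType) (n : nat) (Sigma : set 'rV[R]_n)
    (eps : 'rV[R]_n -> R) : set 'rV[R]_n :=
  [set x | exists2 xi, Sigma xi & enorm (x - xi) < eps xi].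

Definition tubular_nbhd (R : realType) (n : nat) (Sigma : set 'rV[R]_n)
    (eps : 'rV[R]_n -> R) (pi : 'rV[R]_n -> 'rV[R]_n) : Prop :=
  [/\ {within Sigma, continuous eps},
      forall xi, Sigma xi -> 0 < eps xi,
      forall x, tube Sigma eps x -> Sigma (pi x) /\
        forall xi, Sigma xi -> xi <> pi x -> enorm (x - pi x) < enorm (x - xi),
      smooth_open (tube Sigma eps) pi &
      (* pi is a submersion onto Sigma *)
      forall x, tube Sigma eps x -> forall v, tangent_space Sigma (pi x) v ->
        exists u, 'd pi x u = v].

Definition orthonormal_normal_frame (R : realType) (n d : nat)
    (Sigma A : set 'rV[R]_n) (nu : 'I_d -> 'rV[R]_n -> 'rV[R]_n) : Prop :=
  (forall j, smooth_on A (nu j)) /\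
  forall xi, A xi ->
    [/\ forall j, normal_space Sigma xi (nu j xi),
        forall j k, dot (nu j xi) (nu k xi) = (j == k)%:R &
        forall w, normal_space Sigma xi w ->
          exists c : 'I_d -> R, w = \sum_(j < d) c j *: nu j xi].

Definition tube_rho (R : realType) (n : nat) (pi : 'rV[R]_n -> 'rV[R]_n)
    (x : 'rV[R]_n) : R := enorm (x - pi x).

Definition tube_omega (R : realType) (n d : nat) (pi : 'rV[R]_n -> 'rV[R]_n)
    (nu : 'I_d -> 'rV[R]_n -> 'rV[R]_n) (x : 'rV[R]_n) : 'rV[R]_d :=
  \row_(k < d) (dot (nu k (pi x)) (x - pi x) / tube_rho pi x).

Definition polar_map (R : realType) (n d : nat)
    (nu : 'I_d -> 'rV[R]_n -> 'rV[R]_n)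
    (p : 'rV[R]_n * 'rV[R]_d * R) : 'rV[R]_n :=
  p.1.1 + p.2 *: \sum_(j < d) p.1.2 0 j *: nu j p.1.1.

Definition polar_coords (R : realType) (n d : nat) (pi : 'rV[R]_n -> 'rV[R]_n)
    (nu : 'I_d -> 'rV[R]_n -> 'rV[R]_n) (x : 'rV[R]_n) :
    'rV[R]_n * 'rV[R]_d * R :=
  (pi x, tube_omega pi nu x, tube_rho pi x).

Definition adapted_cover (R : realType) (n d : nat) (Sigma : set 'rV[R]_n)
    (eps : 'rV[R]_n -> R) (pi : 'rV[R]_n -> 'rV[R]_n)
    (U : nat -> set 'rV[R]_n)
    (nu : nat -> 'I_d -> 'rV[R]_n -> 'rV[R]_n) : Prop :=
  Sigma `<=` \bigcup_l U l /\
  forall l,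
    [/\ open (U l), bounded_set (U l), U l `<=` tube Sigma eps &
     [/\ U l `&` Sigma !=set0,
      orthonormal_normal_frame Sigma (U l `&` Sigma) (nu l) &
      exists2 r : R, 0 < r &
        diffeo (((Sigma `&` U l) `*` @sphere R d) `*` `]0, r[) (U l `\` Sigma)
          (polar_map (nu l)) (polar_coords pi (nu l))]].

Definition partial (R : realType) (n : nat) (i : 'I_n) (f : 'rV[R]_n -> R) :
    'rV[R]_n -> R := 'D_(delta_mx 0 i) f.

(* The order of differentiation is fixed, but irrelevant for smooth f. *)
Definition dpartial (R : realType) (n : nat) (alpha : 'I_n -> nat)
    (f : 'rV[R]_n -> R) : 'rV[R]_n -> R :=
  foldr (fun i g => iter (alpha i) (@partial R n i) g) f (enum 'I_n).

Definition mdeg (n : nat) (alpha : 'I_n -> nat) : nat := \sum_(i < n) alpha i.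

(* b ~ sum_(j >= m) c_j on D as rho -> 0, uniformly and termwise differentiable;
   the partial sums have N terms, j = m, ..., m + N - 1. *)
Definition strong_expansion (R : realType) (n : nat) (D : set 'rV[R]_n)
    (rho : 'rV[R]_n -> R) (m : int) (b : 'rV[R]_n -> R)
    (c : int -> 'rV[R]_n -> R) : Prop :=
  forall (alpha : 'I_n -> nat) (q : int), exists N0 : nat, forall N : nat,
    (N0 <= N)%N -> exists C delta : R, 0 < delta /\
    forall x, D x -> rho x < delta ->
      `| dpartial alpha b x - \sum_(k < N) dpartial alpha (c (m + k%:Z)) x |
        <= C * rho x ^ q.

(* The space D_{*,Sigma}^{[m;K]}(Omega). Its elements are functions on
   Omega `\` Sigma, represented by total functions whose values elsewhere are
   irrelevant (Omega `\` Sigma being open). *)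
Definition thick_test (R : realType) (n d : nat) (Sigma : set 'rV[R]_n)
    (pi : 'rV[R]_n -> 'rV[R]_n) (U : nat -> set 'rV[R]_n)
    (nu : nat -> 'I_d -> 'rV[R]_n -> 'rV[R]_n)
    (Omega K : set 'rV[R]_n) (m : int) : set ('rV[R]_n -> R) :=
  [set phi |
    [/\ smooth_open (Omega `\` Sigma) phi,
        forall x, (Omega `\` Sigma) x -> ~ K x -> phi x = 0 &
        forall l, (Omega `&` U l) `\` Sigma !=set0 ->
          exists a : int -> 'rV[R]_n * 'rV[R]_d -> R,
            (forall j, m <= j ->
               smooth_on ((Sigma `&` U l) `*` @sphere R d) (a j)) /\
            strong_expansion ((Omega `&` U l) `\` Sigma) (tube_rho pi) m phi
              (fun j x => a j (pi x, tube_omega pi (nu l) x) *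
                          tube_rho pi x ^ j)]].

(* Main.v *)
Require Import Defs.
From HB Require Import structures.
From mathcomp Require Import all_boot all_order all_algebra.
From mathcomp Require Import all_classical all_reals all_analysis.
From mathcomp Require Import ring lra zify.
Import Order.TTheory GRing.Theory Num.Theory.
Import numFieldNormedType.Exports.
Local Open Scope classical_set_scope.
Local Open Scope ring_scope.
Set Implicit Arguments.
Unset Strict Implicit.
Unset Printing Implicit Defensive.


(** It suffices to treat one partial derivative. Differentiating the expansion of
    phi term by term, one has to expand the derivative of each term
    c = a(xi, omega) rho^k again in powers of rho, and to bound the errors
    uniformly up to the boundary of the chart.

    _Expansion of a gradient._ The terms are the functions c that are homogeneous
    of degree k on the normal rays, c (pi x + t (x - pi x)) = t^k c x. Let J(s) be
    the Jacobian of the projection pi at the point ray s x = pi x + s (x - pi x).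
    Since pi is constant along rays, differentiating pi (ray t y) = pi y and
    letting the point tend to Sigma gives (1 - s J1) J(s) = J0 with J0 = J(0) and
    J1 = J'(0) ([Jac_key]): J(s) is the geometric series of the s^l J1^l J0. On the
    other hand grad c (ray s x) = s^(k-1) (1 + (s - 1) J(s)) grad c x
    ([grad_ray]). Hence grad c is a sum of homogeneous parts
    (1 - J0) grad c and J1^l (J0 - J1 J0) grad c, of degrees k - 1 and k + l, and
    the sum telescopes: after L + 1 parts the remainder is exactly
    J1^L J0 grad c ([grad_telescope], [grad_part_homogeneous]). Reading the
    homogeneous parts in polar coordinates gives the new coefficients.

    _Uniform bounds._ Orders of growth are measured by the classes [symb_on], in
    which every derivative may cost one power of rho; they are stable under
    products, and Schwarz's theorem relates them to the derivatives in the
    definition of a strong expansion. The entries of J0 and J1 have orders 0 and 1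
    up to the boundary of a chart, because the closure of the chart is compact and
    pi is smooth near Sigma, so the remainder J1^L J0 grad c is small for large L
    as soon as c has some finite order. This finite order is the delicate point,
    since the normal frame of a chart, and with it the coefficients, may be
    unbounded near the boundary of the chart. First, phi has order m: near a point
    of K on Sigma this follows from the expansion in a chart containing the point
    ([homogeneous_local_bound]), near other points there is nothing to prove, and K
    is compact ([symb_glue]). Secondly, the order passes from phi to the terms of
    its expansion: the Euler field rho d/drho multiplies a term of degree k by k,
    so the terms can be separated by derivatives of their sum
    ([separate_degrees], [terms_order]). *)

(** * Calculus of functions of class C^k *)

Section Ck_calculus.
Variable R : realType.
Implicit Types V W X : normedModType R.

(** g - f vanishes near x, so that its differential at x is 0. *)
Lemma near_eq_diff V W (f g : V -> W) (x : V) :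
  {near x, f =1 g} -> differentiable f x ->
  differentiable g x /\ 'd g x = 'd f x :> (V -> W).
Proof.
move=> fg df.
pose h := g - f.
have h0 : {near x, h =1 cst 0}.
  by near=> y; rewrite /h fctE -(near fg y)// subrr.
have hx : h x = 0 by exact: (nbhs_singleton h0).
pose L : {linear V -> W} := 'd (cst (0 : W)) x.
have L0 : L = 0 :> (V -> W) by exact: diff_cst.
have hs : h \o shift x = cst (h x) + L +o_ 0 id.
  apply/eqaddoP => e e0.
  have hh : \forall y \near 0, h (y + x) = 0.
    by have := h0; rewrite (near_shift 0) /= subr0.
  apply: filterS hh => y hy.
  have -> : (h \o shift x - (cst (h x) + L)) y = 0.
    by rewrite L0 !fctE /= hy// hx addr0 subrr.
  by rewrite normr0 mulr_ge0// ltW.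
have c0 : continuous L by rewrite L0 => y; exact: cst_continuous.
have d0 := diff_unique c0 hs.
have dh : differentiable h x by apply/diff_locallyP; rewrite d0.
have d0y y : 'd h x y = 0 := congr1 (fun F : V -> W => F y) (etrans d0 L0).
have -> : g = f + h by rewrite /h addrC subrK.
split; first exact: differentiableD.
apply: (etrans (diffD df dh)).
by apply/funext => y; exact: (etrans (congr1 (+%R ('d f x y)) (d0y y)) (addr0 _)).
Unshelve. all: by end_near. Qed.

Lemma open_near V (O : set V) (x : V) (P : V -> Prop) :
  open O -> O x -> (forall y, O y -> P y) -> \forall y \near x, P y.
Proof.
move=> oO Ox h; have : nbhs x O by exact: open_nbhs_nbhs.
by apply: filterS => y /h.
Qed.

Lemma Ck_ext V W k (O : set V) (f g : V -> W) : open O ->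
  (forall x, O x -> f x = g x) -> Ck k O f -> Ck k O g.
Proof.
move=> oO; elim: k f g => [|k IH] f g fg /=.
  move=> cf x Ox; have /fg E := Ox.
  have nfg : {near x, f =1 g} by apply: (open_near oO Ox).
  have := cf x Ox; rewrite /prop_for /continuous_at E => cfx.
  exact: cvg_trans (near_eq_cvg nfg) cfx.
move=> [df ddf].
have H x : O x -> differentiable g x /\ 'd g x = 'd f x :> (V -> W).
  move=> Ox; apply: near_eq_diff; last exact: df.
  by apply: (open_near oO Ox).
split=> [x Ox|v]; first by case: (H x Ox).
apply: IH (ddf v) => x Ox; case: (H x Ox) => _ E.
exact: esym (congr1 (fun F : V -> W => F v) E).
Qed.

Lemma Ck_sub V W k (O B : set V) (f : V -> W) : B `<=` O ->
  Ck k O f -> Ck k B f.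
Proof.
move=> OO; elim: k f => [|k IH] f /=; first by move=> cf x /OO; exact: cf.
by move=> [df ddf]; split=> [x /OO|v]; [exact: df|exact: IH].
Qed.

Lemma Ck_local V W k (O : set V) (f : V -> W) :
  (forall x, O x -> exists2 B, B x & Ck k B f) -> Ck k O f.
Proof.
elim: k f => [|k IH] f /= h; first by move=> x /h[B Bx]; apply.
split=> [x /h[B Bx [df _]]|v]; first exact: df.
by apply: IH => x /h[B Bx [_ ddf]]; exists B.
Qed.

Lemma Ck_weaken V W k (O : set V) (f : V -> W) : Ck k.+1 O f -> Ck k O f.
Proof.
elim: k f => [|k IH] f /= [df ddf].
  by move=> x Ox; apply: differentiable_continuous; exact: df.
by split=> // v; apply: IH; exact: ddf.
Qed.

Lemma Ck_cst V W k (O : set V) (a : W) : Ck k O (cst a).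
Proof.
elim: k a => [|k IH] a /=; first by move=> x _; exact: cst_continuous.
split=> [x _|v]; first exact: differentiable_cst.
rewrite (_ : (fun _ => _) = cst 0)//.
by apply/funext => x; rewrite diff_cst.
Qed.

Lemma CkD V W k (O : set V) (f g : V -> W) : open O ->
  Ck k O f -> Ck k O g -> Ck k O (f + g).
Proof.
move=> oO; elim: k f g => [|k IH] f g /=.
  by move=> cf cg x Ox; apply: continuousD; [exact: cf|exact: cg].
move=> [df ddf] [dg ddg]; split=> [x Ox|v].
  by apply: differentiableD; [exact: df|exact: dg].
apply: Ck_ext (IH _ _ (ddf v) (ddg v)) => //= x Ox.
by rewrite diffD; [|exact: df|exact: dg].
Qed.

Lemma Ck_lin_comp V W X k (O : set V) (L : {linear W -> X}) (f : V -> W) :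
  open O -> continuous L -> Ck k O f -> Ck k O (L \o f).
Proof.
move=> oO cL; elim: k f => [|k IH] f /=.
  by move=> cf x Ox; apply: continuous_comp; [exact: cf|exact: cL].
move=> [df ddf].
have dL y : differentiable L y by exact: linear_differentiable.
split=> [x Ox|v]; first by apply: differentiable_comp; [exact: df|].
apply: Ck_ext (IH _ (ddf v)) => //= x Ox.
exact: esym (etrans (congr1 (fun F : V -> X => F v) (diff_comp (df x Ox) (dL _)))
  (congr1 (fun F : W -> X => F ('d f x v)) (diff_lin _ cL))).
Qed.

(** Unlike in [Ck_comp], f may take values in any normed space. *)
Lemma Ck_comp_affine V W X k (O : set W) (L : {linear V -> W}) (a : W)
    (f : W -> X) : open O -> continuous L ->
  Ck k O f -> Ck k [set x | O (L x + a)] (fun x => f (L x + a)).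
Proof.
move=> oO cL.
have dA x : differentiable (fun x => L x + a) x.
  by apply: differentiableD => //; exact: linear_differentiable.
have oA : open [set x | O (L x + a)].
  apply: (open_comp _ oO) => x _.
  by apply: differentiable_continuous; exact: dA.
elim: k f => [|k IH] f /=.
  move=> cf x Ox; apply: (@continuous_comp _ _ _ (fun x => L x + a) f).
    by apply: differentiable_continuous; exact: dA.
  exact: cf.
move=> [df ddf]; split=> [x Ox|v].
  by apply: (@differentiable_comp _ _ _ _ (fun x => L x + a) f) => //; exact: df.
apply: Ck_ext (IH _ (ddf (L v))) => //= x Ox.
have E : 'd ((L : V -> W) + cst a) x v = L v.
  have dL : differentiable L x by exact: linear_differentiable.
  have Z : differentiable (cst a : V -> W) x by [].
  apply: (etrans (congr1 (fun F : V -> W => F v) (diffD dL Z))).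
  apply: (etrans (congr2 +%R (congr1 (fun F : V -> W => F v) (diff_lin _ cL))
    (congr1 (fun F : V -> W => F v) (diff_cst a x)))).
  exact: addr0.
have D := congr1 (fun F : V -> X => F v) (diff_comp (dA x) (df _ Ox)).
exact: esym (etrans D (congr1 ('d f (L x + a)) E)).
Qed.

Lemma CkM V k (O : set V) (f g : V -> R) : open O ->
  Ck k O f -> Ck k O g -> Ck k O (f * g).
Proof.
move=> oO; elim: k f g => [|k IH] f g /=.
  by move=> cf cg x Ox; apply: continuousM; [exact: cf|exact: cg].
move=> Cf Cg; have [df ddf] := Cf; have [dg ddg] := Cg.
split=> [x Ox|v].
  by apply: differentiableM; [exact: df|exact: dg].
have h1 := IH _ _ (Ck_weaken Cf) (ddg v).
have h2 := IH _ _ (Ck_weaken Cg) (ddf v).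
apply: Ck_ext (CkD oO h1 h2) => //= x Ox.
by rewrite diffM//; [exact: df|exact: dg].
Qed.

Lemma CkV V k (O : set V) (f : V -> R) : open O ->
  (forall x, O x -> f x != 0) -> Ck k O f -> Ck k O (fun x => (f x)^-1).
Proof.
move=> oO f0; elim: k => [|k IH].
  by move=> /= cf x Ox; apply: continuousV; [exact: f0|exact: cf].
move=> Cf; have [df ddf] := Cf.
have C1 := IH (Ck_weaken Cf).
split=> [x Ox|v].
  by apply: differentiableV; [exact: df|exact: f0].
have h := CkM oO (CkM oO C1 C1) (ddf v).
have h' := CkM (f := cst (-1)) oO (Ck_cst _ _ _) h.
apply: Ck_ext h' => //= x Ox.
rewrite diffV ?f0//; last exact: df.
rewrite /= !fctE mulN1r /GRing.scale /=.
by rewrite mulNr -exprVn expr2.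
Qed.

Lemma Ck_sum V W k (O : set V) n (f : 'I_n -> V -> W) : open O ->
  (forall i, Ck k O (f i)) -> Ck k O (fun x => \sum_(i < n) f i x).
Proof.
move=> oO; elim: n f => [|n IH] f Cf.
  apply: Ck_ext (@Ck_cst _ _ k O 0) => // x Ox; by rewrite big_ord0.
apply: Ck_ext (CkD oO (IH (fun i => f (widen_ord (leqnSn n) i)) _) (Cf ord_max)).
- by [].
- by move=> x Ox; rewrite big_ord_recr.
- by move=> i; exact: Cf.
Qed.

(** Finite dimension of W, in the form in which the chain rule uses it: along
    the vectors e i the differential of a function on W is a finite sum of the
    directional derivatives that [Ck] tests. *)
Definition coordinates W (N : nat) (e : 'I_N -> W) (l : 'I_N -> {linear W -> R}) :=
  (forall i, continuous (l i)) /\ forall w, w = \sum_(i < N) l i w *: e i.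

(** Expanding the differential of f at g x along the e i turns the derivative of
    the composite into products of functions ('d f _ (e i) o g), which are of
    class C^k by induction, and of derivatives of g. *)
Lemma Ck_comp V W N (e : 'I_N -> W) l k (O : set V) (B : set W) (g : V -> W)
    (f : W -> R) : coordinates e l -> open O ->
  (forall x, O x -> B (g x)) -> Ck k B f -> Ck k O g -> Ck k O (f \o g).
Proof.
move=> [cl el] oO OO; elim: k f => [|k IH] f.
  move=> /= cf cg x Ox; apply: continuous_comp; first exact: cg.
  by apply: cf; exact: OO.
move=> Cf Cg; have [df ddf] := Cf; have [dg ddg] := Cg.
split=> [x Ox|v].
  by apply: differentiable_comp; [exact: dg|apply: df; exact: OO].
have h i : Ck k O (((fun y => 'd f y (e i)) \o g) *
    (l i \o (fun x => 'd g x v))).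
  apply: CkM => //; first exact: IH (ddf _) (Ck_weaken Cg).
  by apply: Ck_lin_comp => //; exact: ddg.
apply: Ck_ext (Ck_sum oO h) => //= x Ox.
rewrite diff_comp//; [|exact: dg|by apply: df; exact: OO].
rewrite /= [in RHS](el ('d g x v)) linear_sum; apply: eq_bigr => i _.
by rewrite linearZ /= fctE mulrC.
Qed.

End Ck_calculus.

(** * Coordinates and partial derivatives *)

Section linear_forms.
Variable R : realType.

Definition rcoord n (i : 'I_n) (x : 'rV[R]_n) : R := x 0 i.

Fact rcoord_is_linear n (i : 'I_n) : linear (@rcoord n i).
Proof. by move=> a x y; rewrite /rcoord !mxE. Qed.

HB.instance Definition _ n (i : 'I_n) :=
  GRing.isLinear.Build R 'rV[R]_n R _ (@rcoord n i) (@rcoord_is_linear n i).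

Lemma rcoord_continuous n (i : 'I_n) : continuous (rcoord i).
Proof. exact: coord_continuous. Qed.

Variables V W : normedModType R.

Definition pfst (w : V * W) : V := w.1.
Fact pfst_is_linear : linear pfst. Proof. by []. Qed.
HB.instance Definition _ := GRing.isLinear.Build R (V * W)%type V _ pfst pfst_is_linear.
Lemma pfst_continuous : continuous pfst.
Proof. by move=> w; exact: cvg_fst. Qed.

Definition psnd (w : V * W) : W := w.2.
Fact psnd_is_linear : linear psnd. Proof. by []. Qed.
HB.instance Definition _ := GRing.isLinear.Build R (V * W)%type W _ psnd psnd_is_linear.
Lemma psnd_continuous : continuous psnd.
Proof. by move=> w; exact: cvg_snd. Qed.

Definition pinl (w : V) : V * W := (w, 0).
Fact pinl_is_linear : linear pinl.
Proof.
move=> a x y; rewrite /pinl; congr pair.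
by rewrite /GRing.scale /= scaler0 addr0.
Qed.
HB.instance Definition _ := GRing.isLinear.Build R V (V * W)%type _ pinl pinl_is_linear.
Lemma pinl_continuous : continuous pinl.
Proof. by move=> w; apply: cvg_pair => //=; exact: cvg_cst. Qed.

Definition line (e : V) (t : R) : V := t *: e.
Fact line_is_linear e : linear (line e).
Proof. by move=> a x y; rewrite /line scalerDl scalerA. Qed.
HB.instance Definition _ e := GRing.isLinear.Build R R V _ (line e) (line_is_linear e).
Lemma line_continuous e : continuous (line e).
Proof. exact: scalel_continuous. Qed.

End linear_forms.

Section coordinate_systems.
Variable R : realType.

Lemma rV_coordinates n :
  coordinates (fun i : 'I_n => delta_mx 0 i : 'rV[R]_n) (fun i => @rcoord R n i).
Proof.
split=> [i|w]; first exact: rcoord_continuous.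
by rewrite [LHS]row_sum_delta.
Qed.

Lemma prod_coordinates (V W : normedModType R) N M
    (e : 'I_N -> V) l (e' : 'I_M -> W) l' :
  coordinates e l -> coordinates e' l' ->
  coordinates
    (fun i : 'I_(N + M) => match fintype.split i with
                           | inl a => (e a, 0)
                           | inr b => (0, e' b) end)
    (fun i : 'I_(N + M) => match fintype.split i with
              | inl a => (l a \o @pfst R V W : {linear (V * W)%type -> R})
              | inr b => (l' b \o @psnd R V W : {linear (V * W)%type -> R}) end).
Proof.
move=> [cl el] [cl' el']; split=> [i|[v w]].
  case: (fintype.split i) => a x.
    by apply: (@continuous_comp _ _ _ (@pfst R V W)); [exact: pfst_continuous|exact: cl].
  by apply: (@continuous_comp _ _ _ (@psnd R V W)); [exact: psnd_continuous|exact: cl'].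
rewrite big_split_ord /=.
have sl i: fintype.split (lshift M i) = inl i := unsplitK (inl i : 'I_N + 'I_M).
have sr i: fintype.split (rshift N i) = inr i := unsplitK (inr i : 'I_N + 'I_M).
under eq_bigr => i _ do rewrite sl.
under [X in _ + X]eq_bigr => i _ do rewrite sr.
rewrite /=.
have -> : \sum_(i < N) l i v *: ((e i, 0) : V * W) = pinl W (\sum_(i < N) l i v *: e i).
  by rewrite linear_sum; apply: eq_bigr => i _; rewrite linearZ.
have -> : \sum_(i < M) l' i w *: ((0, e' i) : V * W) = (0, \sum_(i < M) l' i w *: e' i).
  rewrite (big_morph (fun w : W => (0, w) : V * W) (id1 := 0) (op1 := +%R)) //.
    by apply: eq_bigr => i _; congr pair; rewrite /= scaler0.
  by move=> x y; congr pair; rewrite /= addr0.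
rewrite -el -el'; congr pair; rewrite /=; [by rewrite addr0|by rewrite add0r].
Qed.

End coordinate_systems.

Section partials.
Variable R : realType.

Lemma is_derive_line (V W : normedModType R) (F : V -> W) (y v : V) (t : R) :
  differentiable F (y + t *: v) ->
  is_derive t 1 (fun s : R => F (y + s *: v)) ('D_v F (y + t *: v)).
Proof.
move=> dF.
have E : (fun h : R => h^-1 *: (((fun s : R => F (y + s *: v)) \o shift t) (h *: 1)
    - F (y + t *: v))) =
  (fun h : R => h^-1 *: ((F \o shift (y + t *: v)) (h *: v) - F (y + t *: v))).
  apply/funext => h /=; congr (_ *: (F _ - _)).
  by rewrite [_ *: 1]mulr1 scalerDl addrCA.
have dv : derivable F (y + t *: v) v by exact: diff_derivable.
apply: DeriveDef; first by rewrite /derivable E.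
by rewrite /derive E.
Qed.

Lemma diff_partials n (f : 'rV[R]_n -> R) x v : differentiable f x ->
  'd f x v = \sum_(i < n) v 0 i * partial i f x.
Proof.
move=> df; rewrite {1}(row_sum_delta v) linear_sum; apply: eq_bigr => i _.
by rewrite linearZ /partial deriveE.
Qed.

Variable n : nat.
Implicit Types (f g : 'rV[R]_n -> R) (O : set 'rV[R]_n).

Lemma partial_ext O f g i x : open O -> O x -> (forall y, O y -> f y = g y) ->
  partial i f x = partial i g x.
Proof. by move=> oO Ox fg; apply: near_eq_derive; exact: open_near oO Ox fg. Qed.

Lemma smooth_diff (V W : normedModType R) (O : set V) (f : V -> W) x :
  smooth_open O f -> O x -> differentiable f x.
Proof. by move=> /(_ 1)[+ _]; exact. Qed.

Lemma smooth_cont (V W : normedModType R) (O : set V) (f : V -> W) x :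
  smooth_open O f -> O x -> {for x, continuous f}.
Proof. by move=> /(_ 0); exact. Qed.

Lemma smooth_ext (V W : normedModType R) (O : set V) (f g : V -> W) :
  open O -> (forall x, O x -> f x = g x) -> smooth_open O f -> smooth_open O g.
Proof. by move=> oO fg sf k; exact: Ck_ext oO fg (sf k). Qed.

Lemma smooth_sub (V W : normedModType R) (O B : set V) (f : V -> W) :
  B `<=` O -> smooth_open O f -> smooth_open B f.
Proof. by move=> BO sf k; exact: Ck_sub BO (sf k). Qed.

Lemma smooth_partial O f i : open O -> smooth_open O f -> smooth_open O (partial i f).
Proof.
move=> oO sf k; have [df /(_ (delta_mx 0 i)) ddf] := sf k.+1.
by apply: Ck_ext ddf => // x Ox; rewrite /partial deriveE//; exact: df.
Qed.

Lemma partialD f g i x : differentiable f x -> differentiable g x ->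
  partial i (f + g) x = partial i f x + partial i g x.
Proof. by move=> df dg; rewrite /partial deriveD//; exact: diff_derivable. Qed.

Lemma partialM f g i x : differentiable f x -> differentiable g x ->
  partial i (f * g) x = partial i f x * g x + f x * partial i g x.
Proof.
move=> df dg; rewrite /partial deriveM; [|exact: diff_derivable..].
by rewrite addrC; congr (_ + _); exact: mulrC.
Qed.

Lemma partial_cst a i x : partial i (cst a : 'rV[R]_n -> R) x = 0.
Proof. exact: derive_cst. Qed.

Lemma partial_coord (i j : 'I_n) x : partial i (fun y : 'rV[R]_n => y 0 j) x = (i == j)%:R.
Proof.
have cj : continuous (@rcoord R n j) by exact: rcoord_continuous.
rewrite /partial deriveE; last exact: differentiable_coord.
have E := congr1 (fun F : 'rV[R]_n -> R => F (delta_mx 0 i)) (diff_lin x cj).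
by apply: (etrans E); rewrite /= /rcoord mxE eqxx eq_sym.
Qed.

Lemma partial_comp m (g : 'rV[R]_n -> 'rV[R]_m) (f : 'rV[R]_m -> R) i x :
  differentiable g x -> differentiable f (g x) ->
  partial i (f \o g) x =
  \sum_(j < m) partial i (fun y => g y 0 j) x * partial j f (g x).
Proof.
move=> dg df.
have dgj j : differentiable (fun y => g y 0 j) x.
  exact: (differentiable_comp dg (differentiable_coord _ _ _)).
rewrite {1}/partial deriveE; last exact: differentiable_comp.
apply: (etrans (congr1 (fun F : 'rV[R]_n -> R => F (delta_mx 0 i)) (diff_comp dg df))).
apply: (etrans (diff_partials _ df)); apply: eq_bigr => j _; congr (_ * _).
rewrite /partial deriveE//.
have cj : continuous (@rcoord R m j) by exact: rcoord_continuous.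
have dj y : differentiable (@rcoord R m j) y by exact: linear_differentiable.
have D := congr1 (fun F : 'rV[R]_n -> R => F (delta_mx 0 i)) (diff_comp dg (dj (g x))).
have E := congr1 (fun F : 'rV[R]_m -> R => F ('d g x (delta_mx 0 i))) (diff_lin (g x) cj).
exact: esym (etrans D E).
Qed.

(** The mean value theorem, applied once in each direction of a square of side h
    at x. The left-hand side is symmetric in i and j, the right-hand side is a
    mixed derivative in a prescribed order. *)
Lemma mixed_difference (O : set 'rV[R]_n) f i j x h : smooth_open O f -> open O -> 0 < h ->
  let u := delta_mx 0 i : 'rV[R]_n in let v := delta_mx 0 j : 'rV[R]_n in
  (forall s t, 0 <= s <= h -> 0 <= t <= h -> O (x + s *: u + t *: v)) ->
  exists s t, [/\ 0 <= s <= h, 0 <= t <= h &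
    f (x + h *: u + h *: v) - f (x + h *: u) - (f (x + h *: v) - f x) =
    h ^+ 2 * partial j (partial i f) (x + s *: u + t *: v)].
Proof.
move=> sf oO h0 u v box.
have h0' : 0 <= h by exact: ltW.
have sfi := smooth_partial i oO sf.
pose g s := f (x + h *: v + s *: u) - f (x + s *: u).
have dg s : 0 <= s <= h -> is_derive s 1 g
    (partial i f (x + h *: v + s *: u) - partial i f (x + s *: u)).
  move=> sh; have h1 : differentiable f (x + h *: v + s *: u).
    by apply: (smooth_diff sf); rewrite addrAC; apply: box => //; rewrite h0' lexx.
  have h2 : differentiable f (x + s *: u).
    apply: (smooth_diff sf); have := box s 0 sh.
    by rewrite scale0r addr0; apply; rewrite lexx h0'.
  exact: is_deriveB (is_derive_line h1) (is_derive_line h2).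
have cg : {within `[0, h], continuous g}.
  apply: derivable_within_continuous => s; rewrite in_itv /= => sh.
  by have [] := dg s sh.
have [s /subset_itv_oo_cc] := MVT h0 (fun s H => dg s (subset_itv_oo_cc H)) cg.
rewrite in_itv /= => sh; rewrite subr0 {1 2}/g scale0r !addr0 => Dg.
have dk t : 0 <= t <= h -> is_derive t 1 (fun t => partial i f (x + s *: u + t *: v))
    (partial j (partial i f) (x + s *: u + t *: v)).
  by move=> th; apply: is_derive_line; apply: (smooth_diff sfi); exact: box.
have ck : {within `[0, h], continuous (fun t => partial i f (x + s *: u + t *: v))}.
  apply: derivable_within_continuous => t; rewrite in_itv /= => th.
  by have [] := dk t th.
have [t /subset_itv_oo_cc] := MVT h0 (fun t H => dk t (subset_itv_oo_cc H)) ck.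
rewrite in_itv /= => th; rewrite subr0 scale0r addr0 => Dk.
exists s, t; split=> //.
rewrite (addrAC x (h *: u)) [LHS]Dg (addrAC x (h *: v)) Dk; ring.
Qed.

(** Schwarz's theorem: by [mixed_difference] for (i, j) and for (j, i), the two
    mixed derivatives agree at points arbitrarily close to x. *)
Lemma partial_comm (O : set 'rV[R]_n) f i j x : smooth_open O f -> open O -> O x ->
  partial j (partial i f) x = partial i (partial j f) x.
Proof.
move=> sf oO Ox.
have close2 (a b c e : R) : `|a - c| < e -> `|b - c| < e -> `|a - b| < e + e.
  move=> ac bc; apply: le_lt_trans (ler_distD c _ _) _.
  by rewrite [X in _ + X]distrC; exact: ltrD.
pose A := partial j (partial i f); pose B := partial i (partial j f).
have sA : smooth_open O A by do 2!apply: smooth_partial => //.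
have sB : smooth_open O B by do 2!apply: smooth_partial => //.
apply: contrapT => /eqP AB.
pose e := `|A x - B x| / 2.
have e0 : 0 < e by rewrite divr_gt0// normr_gt0 subr_eq0.
have /nbhs_ballP[r /= r0 rP] : \forall y \near x,
    [/\ O y, `|A x - A y| < e & `|B x - B y| < e].
  have nO : \forall y \near x, O y by exact: open_nbhs_nbhs.
  have nA : \forall y \near x, `|A x - A y| < e.
    by move/cvgrPdist_lt : (smooth_cont sA Ox); apply.
  have nB : \forall y \near x, `|B x - B y| < e.
    by move/cvgrPdist_lt : (smooth_cont sB Ox); apply.
  by apply: filterS3 nO nA nB => y Oy Ay By; split.
(* Two steps of length h from x must stay in the ball of radius r. *)
pose h := r / 3.
have h0 : 0 < h by rewrite divr_gt0.
have hh : h * 1 + h * 1 < r by clear - r0; rewrite /h; lra.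
have le1 k : `|delta_mx 0 k : 'rV[R]_n| <= 1.
  rewrite /Num.Def.normr /= mx_normrE; apply: bigmax_le => // -[a b] _ /=.
  by rewrite mxE; case: (_ && _); rewrite ?normr1 ?normr0.
have box k l s t : 0 <= s <= h -> 0 <= t <= h ->
    ball x r (x + s *: delta_mx 0 k + t *: delta_mx 0 l).
  move=> /andP[s0 sh] /andP[t0 th]; rewrite -ball_normE /ball_ /=.
  rewrite -addrA opprD addrA subrr add0r normrN.
  apply: le_lt_trans (ler_normD _ _) _; rewrite !normrZ !ger0_norm//.
  have h1 := ler_pM s0 (normr_ge0 _) sh (le1 k).
  have h2 := ler_pM t0 (normr_ge0 _) th (le1 l).
  exact: le_lt_trans (lerD h1 h2) hh.
have boxO k l s t : 0 <= s <= h -> 0 <= t <= h ->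
    O (x + s *: delta_mx 0 k + t *: delta_mx 0 l).
  by move=> sh th; have [] := rP _ (box k l s t sh th).
have [s [t [sh th E1]]] := mixed_difference sf oO h0 (boxO i j).
have [s' [t' [sh' th' E2]]] := mixed_difference sf oO h0 (boxO j i).
have EAB : A (x + s *: delta_mx 0 i + t *: delta_mx 0 j) =
           B (x + s' *: delta_mx 0 j + t' *: delta_mx 0 i).
  have h20 : h ^+ 2 != 0 by rewrite expf_neq0// gt_eqF.
  apply: (mulfI h20); apply: (etrans (esym E1)); apply: (etrans _ E2).
  rewrite (addrAC x (h *: delta_mx 0 j)).
  set a := f (_ + _ + _); set b := f (_ + h *: delta_mx 0 i).
  set c := f (x + _); set d := f x.
  by move: a b c d => a b c d; ring.
have [_ h1 _] := rP _ (box i j s t sh th).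
have [_ _ h2] := rP _ (box j i s' t' sh' th').
rewrite EAB in h1.
have := close2 _ _ _ _ h1 h2.
by rewrite /e -splitr ltxx.
Unshelve. all: by end_near. Qed.

End partials.

(** * Smooth functions *)

Section smooth_closure.
Variables (R : realType) (V : normedModType R) (O : set V).
Hypothesis oO : open O.
Implicit Types f g : V -> R.

Lemma smooth_cst (a : R) : smooth_open O (cst a : V -> R).
Proof. by move=> k; exact: Ck_cst. Qed.

Lemma smoothD f g : smooth_open O f -> smooth_open O g -> smooth_open O (f + g).
Proof. by move=> sf sg k; exact: CkD. Qed.

Lemma smoothM f g : smooth_open O f -> smooth_open O g -> smooth_open O (f * g).
Proof. by move=> sf sg k; exact: CkM. Qed.

Lemma smoothZ (a : R) f : smooth_open O f -> smooth_open O (fun x => a * f x).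
Proof. by move=> sf; exact: (smoothM (smooth_cst a) sf). Qed.

Lemma smoothN f : smooth_open O f -> smooth_open O (- f).
Proof.
move=> sf; apply: smooth_ext (smoothZ (-1) sf) => // x _.
by rewrite mulN1r.
Qed.

Lemma smoothB f g : smooth_open O f -> smooth_open O g -> smooth_open O (f - g).
Proof. by move=> sf sg; apply: smoothD => //; exact: smoothN. Qed.

Lemma smoothV f : (forall x, O x -> f x != 0) -> smooth_open O f ->
  smooth_open O (fun x => (f x)^-1).
Proof. by move=> f0 sf k; exact: CkV. Qed.

Lemma smooth_sum N (f : 'I_N -> V -> R) : (forall i, smooth_open O (f i)) ->
  smooth_open O (fun x => \sum_(i < N) f i x).
Proof. by move=> sf k; apply: Ck_sum => // i; exact: sf. Qed.

Lemma smooth_exprz f (k : int) : (forall x, O x -> f x != 0) ->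
  smooth_open O f -> smooth_open O (fun x => f x ^ k).
Proof.
move=> f0 sf.
have pos (j : nat) : smooth_open O (fun x => f x ^+ j).
  elim: j => [|j IH]; first exact: (smooth_cst 1).
  apply: smooth_ext (smoothM sf IH) => // x _.
  by rewrite exprS.
case: k => k; first exact: (pos k).
by apply: smoothV => // x Ox; rewrite expf_neq0// f0.
Qed.

End smooth_closure.

Lemma smooth_entry (R : realType) (V : normedModType R) n (O : set V)
    (g : V -> 'rV[R]_n) (j : 'I_n) :
  open O -> smooth_open O g -> smooth_open O (fun x => g x 0 j).
Proof. by move=> oO sg k; exact: (Ck_lin_comp oO (@rcoord_continuous R n j) (sg k)). Qed.

Lemma smooth_id (R : realType) (V : normedModType R) (O : set V) :
  open O -> smooth_open O (id : V -> V).
Proof.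
move=> oO; elim=> [|k IH] /=; first by move=> x _; exact: cvg_id.
split=> [x _|v]; first by [].
apply: Ck_ext (@Ck_cst R V V k O v) => // x _.
exact: esym (congr1 (fun F : V -> V => F v) (diff_val (f := id))).
Qed.

Lemma smooth_vec (R : realType) n m (O : set 'rV[R]_n) (g : 'rV[R]_n -> 'rV[R]_m) :
  open O -> (forall j, smooth_open O (fun x => g x 0 j)) -> smooth_open O g.
Proof.
move=> oO sg k.
have h j : Ck k O (line (delta_mx 0 j : 'rV[R]_m) \o (fun x => g x 0 j)).
  by apply: Ck_lin_comp => //; [exact: line_continuous|exact: sg].
apply: Ck_ext (Ck_sum oO h) => // x _.
by rewrite [RHS]row_sum_delta.
Qed.

(** * Functions of a given order at the zero set of rho *)

Section symbols.
Variables (R : realType) (n : nat).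
Implicit Types (D : set 'rV[R]_n) (f g rho : 'rV[R]_n -> R).

Definition isO_on D rho (w : int) f : Prop :=
  exists C delta : R, 0 < delta /\
    forall x, D x -> rho x < delta -> `| f x | <= C * rho x ^ w.

(** Each derivative may cost one power of rho, as for a homogeneous function of
    the distance to the zero set. The derivatives are iterated one by one, in
    arbitrary order, so that products and composites can be treated by induction
    on b alone. *)
Fixpoint symb_on D rho (b : nat) (w : int) f : Prop :=
  isO_on D rho w f /\
  (if b is b'.+1 then forall i : 'I_n, symb_on D rho b' (w - 1) (partial i f)
   else True).

Lemma isO_sub D D1 rho w f : D1 `<=` D -> isO_on D rho w f -> isO_on D1 rho w f.
Proof.
by move=> DD [C [e [e0 h]]]; exists C, e; split=> // x /DD; exact: h.
Qed.

Lemma symb_sub D D1 rho b w f : D1 `<=` D -> symb_on D rho b w f -> symb_on D1 rho b w f.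
Proof.
move=> DD; elim: b w f => [|b IH] w f /= [h1 h2]; split=> //.
- exact: isO_sub h1.
- exact: isO_sub h1.
- by move=> i; exact: IH.
Qed.

Variables (D : set 'rV[R]_n) (rho : 'rV[R]_n -> R).
Hypotheses (oD : open D) (rho_gt0 : forall x, D x -> 0 < rho x).
Local Notation isO := (isO_on D rho).
Local Notation symb := (symb_on D rho).
Local Notation sm := (smooth_open D).

Lemma isO_C w f : isO w f -> exists C delta : R, [/\ 0 <= C, 0 < delta, delta <= 1 &
    forall x, D x -> rho x < delta -> `| f x | <= C * rho x ^ w].
Proof.
move=> [C [e [e0 h]]]; exists `|C|, (Num.min e 1); split=> //.
- by rewrite lt_min e0 ltr01.
- by rewrite ge_min lexx orbT.
move=> x Dx; rewrite lt_min => /andP[xe _].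
apply: le_trans (h x Dx xe) _.
by rewrite ler_wpM2r ?ler_norm// exprz_ge0// ltW// rho_gt0.
Qed.

Lemma isO_le w w' f : w' <= w -> isO w f -> isO w' f.
Proof.
move=> ww /isO_C[C [e [C0 e0 e1 h]]]; exists C, e; split=> // x Dx xe.
apply: le_trans (h x Dx xe) _; rewrite ler_wpM2l//.
have r0 := rho_gt0 Dx.
have x1 : rho x < 1 by exact: lt_le_trans xe e1.
have -> : w = w' + `|w - w'|%N%:Z by lia.
rewrite expfzDr ?gt_eqF// ler_piMr ?exprz_ge0//; first exact: ltW.
by apply: exprn_ile1; exact: ltW.
Qed.

Lemma isO_ext w f g : (forall x, D x -> f x = g x) -> isO w f -> isO w g.
Proof.
by move=> fg [C [e [e0 h]]]; exists C, e; split=> // x Dx xe; rewrite -fg// h.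
Qed.

Lemma isOD w f g : isO w f -> isO w g -> isO w (f + g).
Proof.
move=> [C [e [e0 h]]] [C' [e' [e0' h']]]; exists (C + C'), (Num.min e e').
split; first by rewrite lt_min e0.
move=> x Dx; rewrite lt_min => /andP[xe xe'].
rewrite mulrDl; apply: le_trans (ler_normD _ _) _; apply: lerD; [exact: h|exact: h'].
Qed.

Lemma isOM w w' f g : isO w f -> isO w' g -> isO (w + w') (f * g).
Proof.
move=> /isO_C[C [e [C0 e0 _ h]]] /isO_C[C' [e' [C0' e0' _ h']]].
exists (C * C'), (Num.min e e').
split; first by rewrite lt_min e0.
move=> x Dx; rewrite lt_min => /andP[xe xe'].
have r0 := rho_gt0 Dx.
rewrite expfzDr ?gt_eqF// mulrACA [X in `|X|]/(f x * g x) normrM.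
by apply: ler_pM => //; [exact: h|exact: h'].
Qed.

Lemma isO_cst (a : R) : isO 0 (cst a).
Proof.
exists `|a|, 1; split=> // x Dx _.
by rewrite expr0z mulr1.
Qed.

Lemma isO_0 w : isO w (cst 0).
Proof.
exists 0, 1; split=> // x Dx _.
by rewrite normr0 mul0r.
Qed.

Lemma symb_isO b w f : symb b w f -> isO w f.
Proof. by case: b => [|b] []. Qed.

Lemma symb_ext b w f g : (forall x, D x -> f x = g x) -> symb b w f -> symb b w g.
Proof.
elim: b w f g => [|b IH] w f g fg /= [h1 h2]; split=> //.
- exact: isO_ext h1.
- exact: isO_ext h1.
- by move=> i; apply: IH (h2 i) => x Dx; exact: partial_ext oD Dx fg.
Qed.

Lemma symb_le b w w' f : w' <= w -> symb b w f -> symb b w' f.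
Proof.
elim: b w w' f => [|b IH] w w' f ww /= [h1 h2]; split=> //.
- exact: isO_le h1.
- exact: isO_le h1.
- by move=> i; apply: IH (h2 i); rewrite lerD2r.
Qed.

Lemma symb_weak b w f : symb b.+1 w f -> symb b w f.
Proof.
elim: b w f => [|b IH] w f /= [h1 h2]; split=> // i.
by apply: IH; exact: h2.
Qed.

Lemma symb_weaken b b' w f : (b' <= b)%N -> symb b w f -> symb b' w f.
Proof.
move=> /subnK <-; elim: (b - b')%N => [//|k IH].
by rewrite addSn => /symb_weak.
Qed.

Lemma symbD b w f g : sm f -> sm g -> symb b w f -> symb b w g -> symb b w (f + g).
Proof.
elim: b w f g => [|b IH] w f g sf sg /= [h1 h2] [h3 h4]; split=> //.
- exact: isOD.
- exact: isOD.
move=> i; have := IH _ _ _ (smooth_partial i oD sf) (smooth_partial i oD sg) (h2 i) (h4 i).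
by apply: symb_ext => x Dx; rewrite partialD//; [exact: smooth_diff sf Dx|exact: smooth_diff sg Dx].
Qed.

Lemma symbM b w w' f g : sm f -> sm g -> symb b w f -> symb b w' g ->
  symb b (w + w') (f * g).
Proof.
elim: b w w' f g => [|b IH] w w' f g sf sg H H'.
  by split=> //; apply: isOM; [exact: symb_isO H|exact: symb_isO H'].
have [h1 h2] := H; have [h3 h4] := H'.
split=> [|i]; first exact: isOM.
have sfi := smooth_partial i oD sf; have sgi := smooth_partial i oD sg.
have A := IH _ _ _ _ sfi sg (h2 i) (symb_weak H').
have B := IH _ _ _ _ sf sgi (symb_weak H) (h4 i).
rewrite addrAC in A; rewrite addrA in B.
have := symbD (smoothM oD sfi sg) (smoothM oD sf sgi) A B.
apply: symb_ext => x Dx; rewrite partialM//; [exact: smooth_diff sf Dx|exact: smooth_diff sg Dx].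
Qed.

Lemma symb_0 b w : symb b w (cst 0).
Proof.
elim: b w => [|b IH] w; split=> //; [exact: isO_0|exact: isO_0|].
by move=> i; apply: symb_ext (IH _) => x Dx; rewrite partial_cst.
Qed.

Lemma symb_cst b (a : R) : symb b 0 (cst a).
Proof.
case: b => [|b]; split=> //; [exact: isO_cst|exact: isO_cst|].
by move=> i; apply: symb_ext (symb_0 _ _) => x Dx; rewrite partial_cst.
Qed.

Lemma symbZ b w (a : R) f : sm f -> symb b w f -> symb b w (fun x => a * f x).
Proof.
move=> sf h; have := symbM (smooth_cst D a) sf (symb_cst b a) h.
by rewrite add0r.
Qed.

Lemma symbN b w f : sm f -> symb b w f -> symb b w (- f).
Proof.
move=> sf h; apply: symb_ext (symbZ (-1) sf h) => x _.
by rewrite mulN1r.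
Qed.

Lemma symbB b w f g : sm f -> sm g -> symb b w f -> symb b w g -> symb b w (f - g).
Proof.
by move=> sf sg h h'; apply: symbD => //; [exact: smoothN|exact: symbN].
Qed.

Lemma symb_sum b w N (f : 'I_N -> 'rV[R]_n -> R) : (forall i, sm (f i)) ->
  (forall i, symb b w (f i)) -> symb b w (fun x => \sum_(i < N) f i x).
Proof.
elim: N f => [|N IH] f sf h.
  by apply: symb_ext (symb_0 b w) => x _; rewrite big_ord0.
pose g i := f (widen_ord (leqnSn N) i).
have h1 := IH g (fun i => sf _) (fun i => h _).
apply: symb_ext (symbD (smooth_sum oD (fun i => sf (widen_ord (leqnSn N) i)))
  (sf ord_max) h1 (h ord_max)).
by move=> x _; rewrite big_ord_recr.
Qed.

End symbols.

(** * Multi-index derivatives *)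

Section multi_index.
Variables (R : realType) (n : nat) (D : set 'rV[R]_n).
Hypothesis oD : open D.
Implicit Types (f g : 'rV[R]_n -> R) (alpha : 'I_n -> nat) (s : seq 'I_n).
Local Notation sm := (smooth_open D).

(** [dpartial] with its list of coordinates exposed to induction. *)
Definition seq_partial s alpha f : 'rV[R]_n -> R :=
  foldr (fun i g => iter (alpha i) (@partial R n i) g) f s.

Definition raise alpha (i : 'I_n) : 'I_n -> nat := fun j => (alpha j + (j == i))%N.

Lemma smooth_iter_partial i k f : sm f -> sm (iter k (@partial R n i) f).
Proof. by move=> sf; elim: k => //= k IH; exact: smooth_partial. Qed.

Lemma smooth_seq_partial s alpha f : sm f -> sm (seq_partial s alpha f).
Proof. by move=> sf; elim: s => //= i s IH; exact: smooth_iter_partial. Qed.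

Lemma iter_partial_ext i k f g : (forall x, D x -> f x = g x) ->
  forall x, D x -> iter k (@partial R n i) f x = iter k (@partial R n i) g x.
Proof.
by move=> fg; elim: k => //= k IH x Dx; exact: partial_ext oD Dx IH.
Qed.

Lemma dpartial_ext alpha f g : (forall x, D x -> f x = g x) ->
  forall x, D x -> dpartial alpha f x = dpartial alpha g x.
Proof.
move=> fg; rewrite /dpartial; elim: (enum 'I_n) => //= i s IH.
exact: iter_partial_ext.
Qed.

Lemma iter_partial_comm i j k f : sm f ->
  forall x, D x -> partial i (iter k (@partial R n j) f) x =
    iter k (@partial R n j) (partial i f) x.
Proof.
move=> sf; elim: k => //= k IH x Dx.
rewrite (partial_comm j i (smooth_iter_partial j k sf) oD Dx).
exact: partial_ext oD Dx IH.
Qed.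

Lemma seq_partial_comm i s alpha f : sm f ->
  forall x, D x -> partial i (seq_partial s alpha f) x =
    seq_partial s alpha (partial i f) x.
Proof.
move=> sf; elim: s => //= j s IH x Dx.
rewrite iter_partial_comm//; last exact: smooth_seq_partial.
exact: iter_partial_ext.
Qed.

Lemma seq_partial_raise_out i s alpha f : i \notin s ->
  seq_partial s (raise alpha i) f = seq_partial s alpha f.
Proof.
elim: s => //= j s IH; rewrite inE negb_or eq_sym => /andP[/negPf ij /IH ->].
by rewrite (_ : raise alpha i j = alpha j)// /raise ij addn0.
Qed.

(** Partial derivatives commute, so an additional one can be moved to its place
    in the order fixed by s. *)
Lemma seq_partial_raise i s alpha f : sm f -> uniq s -> i \in s ->
  forall x, D x -> seq_partial s (raise alpha i) f x =
    partial i (seq_partial s alpha f) x.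
Proof.
move=> sf; elim: s => //= j s IH /andP[js us]; rewrite inE.
have [ij|ij] := eqVneq i j => /=.
  by move: js; rewrite -ij => js _ x Dx; rewrite seq_partial_raise_out// /raise eqxx addn1.
move=> si x Dx; rewrite iter_partial_comm//; last exact: smooth_seq_partial.
rewrite {1}/raise eq_sym (negPf ij) addn0.
by apply: iter_partial_ext => //; exact: IH.
Qed.

Lemma dpartial_partial i alpha f : sm f -> forall x, D x ->
  dpartial alpha (partial i f) x = dpartial (raise alpha i) f x.
Proof.
move=> sf x Dx; rewrite [RHS](seq_partial_raise alpha sf (enum_uniq _) (mem_enum _ i))//.
by rewrite seq_partial_comm.
Qed.

Lemma dpartial0 f : dpartial (fun _ => 0)%N f = f.
Proof. by rewrite /dpartial; elim: (enum 'I_n). Qed.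

Lemma iter_partialD i k f g : sm f -> sm g -> forall x, D x ->
  iter k (@partial R n i) (f + g) x =
  iter k (@partial R n i) f x + iter k (@partial R n i) g x.
Proof.
move=> sf sg; elim: k => //= k IH x Dx.
rewrite (partial_ext i oD Dx IH) -[RHS]partialD//.
- by apply: smooth_diff Dx; exact: smooth_iter_partial.
- by apply: smooth_diff Dx; exact: smooth_iter_partial.
Qed.

Lemma dpartialD alpha f g : sm f -> sm g -> forall x, D x ->
  dpartial alpha (f + g) x = dpartial alpha f x + dpartial alpha g x.
Proof.
move=> sf sg; rewrite /dpartial; elim: (enum 'I_n) => //= i s IH x Dx.
rewrite (iter_partial_ext _ _ IH)//.
by apply: (iter_partialD i (alpha i) (smooth_seq_partial s alpha sf)
  (smooth_seq_partial s alpha sg)).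
Qed.

Lemma iter_partial_cst0 i k : iter k (@partial R n i) (cst 0) = cst 0.
Proof.
elim: k => //= k ->; apply/funext => x; exact: partial_cst.
Qed.

Lemma dpartial_cst0 alpha : dpartial alpha (cst 0 : 'rV[R]_n -> R) = cst 0.
Proof.
rewrite /dpartial; elim: (enum 'I_n) => //= i s ->.
exact: iter_partial_cst0.
Qed.

Lemma dpartialN alpha f : sm f -> forall x, D x ->
  dpartial alpha (- f) x = - dpartial alpha f x.
Proof.
move=> sf x Dx; apply/eqP; rewrite -addr_eq0 addrC.
rewrite -(dpartialD alpha sf (smoothN oD sf))//.
by rewrite subrr (_ : 0 = cst 0)// dpartial_cst0.
Qed.

Lemma dpartialB alpha f g : sm f -> sm g -> forall x, D x ->
  dpartial alpha (f - g) x = dpartial alpha f x - dpartial alpha g x.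
Proof.
by move=> sf sg x Dx; rewrite dpartialD ?dpartialN//; exact: smoothN.
Qed.

Lemma dpartial_sum alpha N (f : 'I_N -> 'rV[R]_n -> R) :
  (forall k, sm (f k)) -> forall x, D x ->
  dpartial alpha (fun y => \sum_(k < N) f k y) x = \sum_(k < N) dpartial alpha (f k) x.
Proof.
elim: N f => [|N IH] f sf x Dx.
  rewrite big_ord0 (@dpartial_ext alpha _ (cst 0))//; first by rewrite dpartial_cst0.
  by move=> y _; rewrite big_ord0.
pose g := fun y => \sum_(k < N) f (widen_ord (leqnSn N) k) y.
rewrite (@dpartial_ext alpha _ (g + f ord_max))//; last first.
  by move=> y _; rewrite big_ord_recr.
rewrite dpartialD//; last by apply: smooth_sum => // i; exact: sf.
by rewrite big_ord_recr /= IH.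
Qed.

Lemma partial_as_dpartial i f : partial i f = dpartial (fun j => (j == i)%N) f.
Proof.
rewrite /dpartial.
have : i \in enum 'I_n by rewrite mem_enum.
have := enum_uniq 'I_n.
elim: (enum 'I_n) => //= j s IH /andP[js us]; rewrite inE.
have out : i \notin s ->
    foldr (fun j g => iter (j == i) (@partial R n j) g) f s = f.
  elim: s {IH js us} => //= k s IH; rewrite inE negb_or => /andP[ik /IH ->].
  by rewrite eq_sym (negPf ik).
have [ij|ij] := eqVneq i j => /=.
  by move=> _; move: js; rewrite -ij => /out ->.
by move=> si; rewrite IH.
Qed.

End multi_index.

(** * Strong expansions and orders of growth *)

Section symbol_expansion.
Variables (R : realType) (n : nat) (D : set 'rV[R]_n) (rho : 'rV[R]_n -> R).
Hypotheses (oD : open D) (rho_gt0 : forall x, D x -> 0 < rho x).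
Implicit Types (f g phi : 'rV[R]_n -> R) (c : int -> 'rV[R]_n -> R).
Local Notation sm := (smooth_open D).
Local Notation symb := (symb_on D rho).
Local Notation isO := (isO_on D rho).

Lemma symb_iter i k b w f : symb (b + k) w f ->
  symb b (w - k%:Z) (iter k (@partial R n i) f).
Proof.
elim: k b w f => [|k IH] b w f; first by rewrite addn0 subr0.
rewrite addnS iterSr => -[_ /(_ i)] /IH.
have -> : w - 1 - k%:Z = w - k.+1%:Z by lia.
by [].
Qed.

Lemma symb_dpartial alpha b w f : symb (b + mdeg alpha) w f ->
  symb b (w - (mdeg alpha)%:Z) (dpartial alpha f).
Proof.
rewrite /mdeg /dpartial -big_enum /=.
elim: (enum 'I_n) b => [|i s IH] b; first by rewrite big_nil addn0 subr0.
rewrite big_cons addnA => h /=.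
have -> : w - (alpha i + \sum_(j <- s) alpha j)%N%:Z =
  w - (\sum_(j <- s) alpha j)%N%:Z - (alpha i)%:Z by lia.
exact: symb_iter (IH _ h).
Qed.

Lemma strong_expansion_partial m phi c i :
  sm phi -> (forall k : nat, sm (c (m + k%:Z))) ->
  strong_expansion D rho m phi c ->
  strong_expansion D rho m (partial i phi) (fun j => partial i (c j)).
Proof.
move=> sphi sc H alpha q; have [N0 h] := H (raise alpha i) q.
exists N0 => N /h[C [e [e0 {}h]]]; exists C, e; split=> // x Dx xe.
rewrite (dpartial_partial oD)//.
under eq_bigr => k _ do rewrite (dpartial_partial oD)//.
exact: h.
Qed.

(** The expansion controls derivatives taken in one fixed order, and with a rank
    N0 that depends on the derivative; here all iterated derivatives up to order
    b are controlled from a common rank on. *)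
Lemma strong_expansion_symb m phi c b q :
  sm phi -> (forall k : nat, sm (c (m + k%:Z))) ->
  strong_expansion D rho m phi c ->
  exists N0 : nat, forall N : nat, (N0 <= N)%N ->
    symb b q (fun x => phi x - \sum_(k < N) c (m + k%:Z) x).
Proof.
elim: b phi c q => [|b IH] phi c q sphi sc H;
  have [N0 h] := H (fun _ => 0%N) q.
  exists N0 => N /h[C [e [e0 {}h]]]; split=> //; exists C, e; split=> // x Dx xe.
  have := h x Dx xe; rewrite dpartial0.
  by under eq_bigr => k _ do rewrite dpartial0.
have /choice[F hF] : forall i : 'I_n, exists N0 : nat, forall N : nat, (N0 <= N)%N ->
    symb b (q - 1) (fun x => partial i phi x - \sum_(k < N) partial i (c (m + k%:Z)) x).
  move=> i; apply: (IH (partial i phi) (fun j => partial i (c j))).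
  - exact: smooth_partial.
  - by move=> k; exact: smooth_partial.
  - exact: strong_expansion_partial.
exists (maxn N0 (\max_(i < n) F i)) => N; rewrite geq_max => /andP[/h] {}h /bigmax_leqP FN.
have [C [e [e0 {}h]]] := h; split=> [|i].
  exists C, e; split=> // x Dx xe.
  have := h x Dx xe; rewrite dpartial0.
  by under eq_bigr => k _ do rewrite dpartial0.
apply: symb_ext (hF i N (FN i isT)) => // x Dx.
have sS : sm (fun x => \sum_(k < N) c (m + k%:Z) x) by exact: smooth_sum.
rewrite !partial_as_dpartial (dpartialB oD)// (dpartial_sum oD)//.
by under eq_bigr => k _ do rewrite partial_as_dpartial.
Qed.

(** The loss of one power of rho per derivative is compensated by asking for a
    higher order q + |alpha| of the remainder. *)
Lemma symb_strong_expansion m phi c :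
  sm phi -> (forall k : nat, sm (c (m + k%:Z))) ->
  (forall b q, exists N0 : nat, forall N : nat, (N0 <= N)%N ->
    symb b q (fun x => phi x - \sum_(k < N) c (m + k%:Z) x)) ->
  strong_expansion D rho m phi c.
Proof.
move=> sphi sc H alpha q.
have [N0 h] := H (mdeg alpha) (q + (mdeg alpha)%:Z); exists N0 => N /h.
rewrite -[X in symb X]add0n => /symb_dpartial/symb_isO[C [e [e0 {}h]]].
exists C, e; split=> // x Dx xe.
have sS : sm (fun x => \sum_(k < N) c (m + k%:Z) x) by exact: smooth_sum.
have := h x Dx xe; rewrite (dpartialB oD)// (dpartial_sum oD)//.
by rewrite addrK.
Qed.

End symbol_expansion.

(** * Homogeneous functions on normal rays *)

Section one_variable.
Variable R : realType.

(** Identities along a ray hold only at positive distance from its foot; this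
    lemma recovers from them the values and first derivatives at the foot. *)
Lemma right_zero (F : R -> R) (a e : R) : 0 < e -> is_derive (0 : R) 1 F a ->
  (forall s, 0 < s -> s < e -> F s = 0) -> F 0 = 0 /\ a = 0.
Proof.
move=> e0 dF F0.
have pick d : 0 < d -> exists s : R, [/\ 0 < s, s < d & s < e].
  move=> d0; exists (Num.min d e / 2).
  have m0 : 0 < Num.min d e by rewrite lt_min d0.
  have m2 : Num.min d e / 2 < Num.min d e by rewrite ltr_pdivrMr// ltr_pMr// ltr1n.
  split; first by rewrite divr_gt0.
    by apply: lt_le_trans m2 _; rewrite ge_min lexx.
  by apply: lt_le_trans m2 _; rewrite ge_min lexx orbT.
have dv : derivable F (0 : R) 1 by case: dF.
have F00 : F 0 = 0.
  apply: contrapT => /eqP nF.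
  have cF : {for 0, continuous F}.
    by apply: differentiable_continuous; exact/derivable1_diffP.
  have nF0 : 0 < `|F 0| by rewrite normr_gt0.
  move/cvgrPdist_lt : cF => /(_ _ nF0) /nbhs_ballP[d /= d0 h].
  have [s [s0 sd se]] := pick d d0.
  have := h s; rewrite /ball /= sub0r normrN gtr0_norm// => /(_ sd).
  by rewrite (F0 s)// subr0 ltxx.
split=> //.
apply: contrapT => /eqP na.
have na0 : 0 < `|a| by rewrite normr_gt0.
have : h^-1 *: (F (h *: 1 + 0) - F 0) @[h --> 0^'] --> a.
  by rewrite -(derive_val (is_derive := dF)) /=; exact: dv.
move/cvgrPdist_lt => /(_ _ na0) /nbhs_ballP[d /= d0 h].
have [s [s0 sd se]] := pick d d0.
have := h s; rewrite /ball /= sub0r normrN gtr0_norm// => /(_ sd).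
rewrite gt_eqF// => /(_ isT).
by rewrite [_ *: 1]mulr1 addr0 (F0 s)// F00 subr0 scaler0 subr0 ltxx.
Qed.

Lemma is_derive_exprz (k : int) : is_derive (1 : R) 1 (fun t : R => t ^ k) k%:~R.
Proof.
have pos (j : nat) : is_derive (1 : R) 1 (fun t : R => t ^+ j) j%:R.
  apply: DeriveDef; first exact: exprn_derivable.
  rewrite exp_derive expr1n [_ *: 1]mulr1.
  by rewrite [_ *: 1]mulr1.
case: k => k; first exact: (pos k).
have [d1 d2] := pos k.+1.
have nz : (1 : R) ^+ k.+1 != 0 by rewrite expr1n oner_neq0.
apply: DeriveDef.
  exact: (@derivableV R R (fun t : R => t ^+ k.+1) 1 1 nz d1).
apply: (etrans (@deriveV R R (fun t : R => t ^+ k.+1) 1 1 nz d1)).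
rewrite d2 expr1n expr1n invr1 NegzE mulrNz.
by rewrite scaleN1r.
Qed.

End one_variable.

Lemma iter_mulmxZ (R : realType) n (a : R) (A : 'M[R]_n) (X : 'cV[R]_n) l :
  iter l (mulmx (a *: A)) X = a ^+ l *: iter l (mulmx A) X.
Proof.
elim: l => /= [|l ->]; first by rewrite scale1r.
by rewrite -scalemxAl -scalemxAr scalerA -exprS.
Qed.

Lemma iter_mulmxDl (R : realType) n (A : 'M[R]_n) (X Y : 'cV[R]_n) l :
  iter l (mulmx A) (X + Y) = iter l (mulmx A) X + iter l (mulmx A) Y.
Proof. by elim: l => //= l ->; rewrite mulmxDr. Qed.

Lemma iter_mulmx_scale (R : realType) n (A : 'M[R]_n) (a : R) (X : 'cV[R]_n) l :
  iter l (mulmx A) (a *: X) = a *: iter l (mulmx A) X.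
Proof. by elim: l => //= l ->; rewrite scalemxAr. Qed.

Section rays.
Variables (R : realType) (n : nat).
Variables (V T : set 'rV[R]_n) (pi : 'rV[R]_n -> 'rV[R]_n) (r : R).
Local Notation rho := (tube_rho pi).

Definition ray (t : R) (x : 'rV[R]_n) : 'rV[R]_n := pi x + t *: (x - pi x).

(** In polar coordinates V is a product with the interval of radii below r. The
    record keeps what this says about rays, without reference to a frame. *)
Record radial_region : Prop := RadialRegion {
  radial_open : open V;
  radial_tube : open T;
  radial_smooth : smooth_open T pi;
  radial_sub : V `<=` T;
  radial_foot : forall x, V x -> T (pi x);
  radial_gt0 : forall x, V x -> 0 < rho x;
  radial_ltr : forall x, V x -> rho x < r;
  radial_stable : forall x t, V x -> 0 < t -> t * rho x < r -> V (ray t x);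
  radial_pi : forall x t, V x -> 0 < t -> t * rho x < r -> pi (ray t x) = pi x;
  radial_rho : forall x t, V x -> 0 < t -> t * rho x < r -> rho (ray t x) = t * rho x;
  radial_cont : forall x, V x -> {for x, continuous rho} }.

Hypothesis ch : radial_region.
Let oV := radial_open ch.
Let oT := radial_tube ch.
Let spi := radial_smooth ch.
Let VT := radial_sub ch.
Let VpiT := radial_foot ch.
Let rho_gt0 := radial_gt0 ch.
Let rho_ltr := radial_ltr ch.
Let rayV := radial_stable ch.
Let pi_ray := radial_pi ch.
Let rho_ray := radial_rho ch.
Let rho_cont := radial_cont ch.
Let smooth_picoord j : smooth_open T (fun z => pi z 0 j) := smooth_entry j oT spi.

Definition homogeneous (k : int) (c : 'rV[R]_n -> R) : Prop :=
  forall x t, V x -> 0 < t -> t * rho x < r -> c (ray t x) = t ^ k * c x.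

(** The derivatives along the i-th vector form row i, so that the Jacobian of a
    composite is the product of the Jacobians from left to right. *)
Definition Jac (y : 'rV[R]_n) : 'M[R]_n :=
  \matrix_(i, j) partial i (fun z => pi z 0 j) y.

Definition Jac0 x : 'M[R]_n := Jac (pi x).

(** The derivative at s = 0 of the Jacobian of pi at [ray s x], see
    [is_derive_Jac]. *)
Definition Jac1 x : 'M[R]_n := \matrix_(i, j)
  \sum_(k < n) (x - pi x) 0 k * partial k (fun y => Jac y i j) (pi x).

Definition grad (c : 'rV[R]_n -> R) (x : 'rV[R]_n) : 'cV[R]_n :=
  \col_i partial i c x.

Lemma ray1 x : ray 1 x = x.
Proof. by rewrite /ray scale1r addrC subrK. Qed.

Lemma ray_ray x s t : V x -> 0 < s -> s * rho x < r -> ray t (ray s x) = ray (t * s) x.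
Proof.
move=> Vx s0 sr; rewrite {1}/ray pi_ray// /ray; congr (_ + _).
by rewrite [pi x + _]addrC addrK scalerA.
Qed.

Lemma smooth_Jac i j : smooth_open T (fun y => Jac y i j).
Proof.
apply: smooth_ext (smooth_partial i oT (smooth_picoord j)) => // x _.
by rewrite mxE.
Qed.

Lemma diff_ray t x : T x -> differentiable (ray t) x.
Proof.
move=> Tx; have dp := smooth_diff spi Tx.
apply: (@differentiableD _ _ _ pi (fun y => t *: (y - pi y))) => //.
apply: (@differentiableZ _ _ _ (id - pi)).
exact: differentiableB.
Qed.

Lemma partial_ray t x i j : T x ->
  partial i (fun y => ray t y 0 j) x = (t%:M + (1 - t) *: Jac x) i j.
Proof.
move=> Tx.
have dp := smooth_diff (smooth_picoord j) Tx.
have dc : differentiable (fun y : 'rV[R]_n => y 0 j) x by exact: differentiable_coord.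
have -> : (fun y => ray t y 0 j) =
    (cst t * (fun y : 'rV[R]_n => y 0 j)) + (cst (1 - t) * (fun y => pi y 0 j)).
  have H (a b : R) : b + t * (a - b) = t * a + (1 - t) * b by ring.
  by apply/funext => y; rewrite /ray !mxE; exact: H.
have dt (a : R) : differentiable (cst a : 'rV[R]_n -> R) x by [].
rewrite partialD; [|exact: differentiableM..].
rewrite !partialM// !partial_cst partial_coord !mxE.
rewrite !mul0r !add0r.
by rewrite mulr_natr.
Qed.

Lemma near_ray x t : V x -> t * rho x < r ->
  exists2 B, open B & B x /\ forall y, B y -> V y /\ t * rho y < r.
Proof.
move=> Vx tr.
have : \forall y \near x, V y /\ t * rho y < r.
  have nV : \forall y \near x, V y by exact: open_nbhs_nbhs.
  have ct : {for x, continuous (cst t : 'rV[R]_n -> R)} by exact: cst_continuous.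
  have cr : {for x, continuous (cst t * rho)} := continuousM ct (rho_cont Vx).
  have nr := cvgr_lt _ cr _ tr.
  by apply: filterS2 nV (nr _) => y.
move=> h; exists [set y | V y /\ t * rho y < r]°; first exact: open_interior.
by split=> // y /interior_subset.
Qed.

(** The chain rule for pi (ray (t / s) y) = pi y at the point y = ray s x. *)
Lemma Jac_ray x s t : V x -> 0 < s -> 0 < t -> s * rho x < r -> t * rho x < r ->
  s *: Jac (ray s x) = (t%:M + (s - t) *: Jac (ray s x)) *m Jac (ray t x).
Proof.
move=> Vx s0 t0 sr tr.
pose z := ray s x; have Vz : V z by exact: rayV.
have ts0 : 0 < t / s by exact: divr_gt0.
have tsr : t / s * rho z < r by rewrite rho_ray// mulrA divfK ?gt_eqF.
have rz : ray (t / s) z = ray t x by rewrite ray_ray// divfK ?gt_eqF.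
have Tt : T (ray t x) by apply: VT; exact: rayV.
have [B oB [Bz hB]] := near_ray Vz tsr.
have E : Jac z = ((t / s)%:M + (1 - t / s) *: Jac z) *m Jac (ray t x).
  apply/matrixP => i j; rewrite mxE.
  rewrite (partial_ext (g := (fun y => pi y 0 j) \o ray (t / s)) i oB Bz); last first.
    by move=> y /hB[Vy yr] /=; rewrite pi_ray.
  rewrite partial_comp; first last.
  - by rewrite rz; exact: smooth_diff (smooth_picoord j) Tt.
  - by apply: diff_ray; exact: VT.
  rewrite mxE; apply: eq_bigr => k _; rewrite partial_ray; last exact: VT.
  by rewrite rz [Jac (ray t x) _ _]mxE.
rewrite -/z {1}E scalemxAl; congr (_ *m _).
rewrite scalerDr scale_scalar_mx scalerA mulrBr mulr1.
by rewrite mulrCA divff ?gt_eqF// mulr1.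
Qed.

Lemma is_derive_Jac x i j : V x ->
  is_derive (0 : R) 1 (fun s : R => Jac (ray s x) i j) (Jac1 x i j).
Proof.
move=> Vx.
have d : differentiable (fun y => Jac y i j) (pi x).
  by apply: smooth_diff (smooth_Jac i j) _; exact: VpiT.
have := @is_derive_line R _ _ (fun y => Jac y i j) (pi x) (x - pi x) 0.
rewrite scale0r addr0 => /(_ d) h.
suff E : 'D_(x - pi x) (fun y => Jac y i j) (pi x) = Jac1 x i j by rewrite -E.
by rewrite deriveE// diff_partials// mxE.
Qed.

(** Both sides of [Jac_ray] are differentiable in s at 0. Comparing their values
    there gives the first equation, comparing their derivatives the second one.
    The second equation sums up the Taylor expansion of the Jacobian along the
    ray as the geometric series of the powers of t Jac1, applied to Jac0. *)
Lemma Jac_key x t : V x -> 0 < t -> t * rho x < r ->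
  Jac0 x *m Jac (ray t x) = Jac (ray t x) /\
  (1%:M - t *: Jac1 x) *m Jac (ray t x) = Jac0 x.
Proof.
move=> Vx t0 tr.
have ray0 : ray 0 x = pi x by rewrite /ray scale0r addr0.
pose N := Jac (ray t x).
have rx := rho_gt0 Vx.
have e0 : 0 < r / rho x by rewrite divr_gt0// (lt_trans rx)// rho_ltr.
have key i j : Jac0 x i j - ((Jac0 x - t *: Jac1 x) *m N) i j = 0 /\
    t * (N i j - (Jac0 x *m N) i j) = 0.
  pose F s := s * Jac (ray s x) i j -
     (t * N i j + (s - t) * \sum_(k < n) Jac (ray s x) i k * N k j).
  have F0 s : 0 < s -> s < r / rho x -> F s = 0.
    move=> s0; rewrite ltr_pdivlMr// => sr; rewrite /F.
    have := congr1 (fun M : 'M[R]_n => M i j) (Jac_ray Vx s0 t0 sr tr).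
    rewrite -/N mulmxDl -scalemxAl mul_scalar_mx !mxE => ->.
    by rewrite subrr.
  have dM i' j' := is_derive_Jac i' j' Vx.
  have dF : is_derive (0 : R) 1 F
      (Jac0 x i j - (\sum_(k < n) Jac0 x i k * N k j - t * \sum_(k < n) Jac1 x i k * N k j)).
    have dC (a : R) : is_derive (0 : R) (1 : R) (cst a) 0 by exact: is_derive_cst.
    have dI : is_derive (0 : R) (1 : R) id 1 by exact: is_derive_id.
    have dS := is_derive_sum (fun k => is_deriveM (dM i k) (dC (N k j))).
    have := is_deriveB (is_deriveM dI (dM i j))
      (is_deriveD (dC (t * N i j)) (is_deriveM (is_deriveB dI (dC t)) dS)).
    set F1 := (X in is_derive _ _ X _) => dF1.
    have -> : F = F1.
      apply/funext => s; rewrite /F /F1 !fctE /= fct_sumE.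
      by [].
    apply: is_derive_eq dF1 _.
    have -> : (\sum_(k < n) (fun s : R => Jac (ray s x) i k) * cst (N k j)) 0 =
        \sum_(k < n) Jac0 x i k * N k j.
      transitivity (\sum_(k < n) Jac (ray 0 x) i k * N k j); first by rewrite fct_sumE.
      by rewrite ray0.
    under eq_bigr => k _ do rewrite scaler0 add0r [_ *: _]mulrC.
    rewrite ray0 -/(Jac0 x).
    have alg (a b S0 S1 : R) :
      0 * a + b * 1 - (0 + ((0 - t) * S1 + S0 * (1 - 0))) = b - (S0 - t * S1) by ring.
    exact: alg.
  have [E1 E2] := right_zero e0 dF F0.
  split.
    rewrite mulmxBl -scalemxAl -E2 !mxE.
    by [].
  move: E1; rewrite /F ray0 -/(Jac0 x) mul0r sub0r sub0r mulNr => /eqP.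
  by rewrite oppr_eq0 -mulrBr => /eqP; rewrite [X in N i j - X]mxE.
split; apply/matrixP => i j; have [E1 E2] := key i j.
  move/eqP: E2; rewrite mulf_eq0 gt_eqF//= subr_eq0 => /eqP; exact: esym.
have JN : Jac0 x *m N = N.
  apply/matrixP => k l; have [_ /eqP] := key k l.
  by rewrite mulf_eq0 gt_eqF//= subr_eq0 => /eqP.
move/eqP: E1; rewrite subr_eq0 mulmxBl JN => /eqP ->.
by rewrite mulmxBl mul1mx.
Qed.

(** Differentiating c y = s^k c (ray s^-1 y) at y = ray s x, rather than the
    relation for ray s at x, produces the gradient at ray s x without inverting a
    matrix. *)
Lemma grad_ray c (k : int) x s : smooth_open V c -> homogeneous k c ->
  V x -> 0 < s -> s * rho x < r ->
  grad c (ray s x) = s ^ (k - 1) *: ((1%:M + (s - 1) *: Jac (ray s x)) *m grad c x).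
Proof.
move=> sc hc Vx s0 sr.
pose z := ray s x; have Vz : V z by exact: rayV.
have rx : rho x < r by exact: rho_ltr.
have sr1 : s^-1 * rho z < r by rewrite rho_ray// mulKf ?gt_eqF.
have rz : ray s^-1 z = x by rewrite ray_ray// mulVf ?gt_eqF// ray1.
have si : 0 < s^-1 by rewrite invr_gt0.
have [B oB [Bz hB]] := near_ray Vz sr1.
have sV y : V y -> s^-1 * rho y < r -> c y = s ^ k * c (ray s^-1 y).
  by move=> Vy yr; rewrite hc// exprz_inv mulrA -expfzDr ?gt_eqF// subrr expr0z mul1r.
apply/matrixP => i j; rewrite mxE -/z.
rewrite (partial_ext (g := cst (s ^ k) * (c \o ray s^-1)) i oB Bz); last first.
  by move=> y /hB[Vy yr]; exact: sV.
have dc : differentiable c (ray s^-1 z) by rewrite rz; exact: smooth_diff sc Vx.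
have dr : differentiable (ray s^-1) z by apply: diff_ray; exact: VT.
have dcr : differentiable (c \o ray s^-1) z := differentiable_comp dr dc.
have dk : differentiable (cst (s ^ k) : 'rV[R]_n -> R) z := differentiable_cst _ _.
rewrite (partialM i dk dcr) partial_cst mul0r add0r (partial_comp i dr dc) rz.
rewrite [RHS]mxE mxE !mulr_sumr; apply: eq_bigr => l _.
rewrite partial_ray; last exact: VT.
rewrite [grad c x _ _]mxE mulrA mulrA; congr (_ * _).
rewrite !mxE -/z.
have -> : s ^ (k - 1) = s ^ k * s^-1 by rewrite expfzDr ?gt_eqF.
have sn0 : s != 0 by rewrite gt_eqF.
have alg (a J K : R) : K * (s^-1 * a + (1 - s^-1) * J) = K * s^-1 * (a + (s - 1) * J).
  by field.
rewrite -[s^-1 *+ _]mulr_natr; exact: alg.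
Qed.

Lemma Jac0_ray x s : V x -> 0 < s -> s * rho x < r -> Jac0 (ray s x) = Jac0 x.
Proof. by move=> Vx s0 sr; rewrite /Jac0 pi_ray. Qed.

Lemma Jac1_ray x s : V x -> 0 < s -> s * rho x < r -> Jac1 (ray s x) = s *: Jac1 x.
Proof.
move=> Vx s0 sr; apply/matrixP => i j; rewrite !mxE mulr_sumr.
apply: eq_bigr => k _; rewrite pi_ray// mulrA; congr (_ * _).
by rewrite /ray !mxE addrC addKr.
Qed.

(** By [Jac_key] the Jacobian at ray s x in [grad_ray] is the sum of the
    s^l Jac1^l Jac0; [grad_part c l] collects the coefficient of s^l in
    s^(1 - k) grad c (ray s x), and is therefore homogeneous of degree
    k - 1 + l. *)
Definition grad_part (c : 'rV[R]_n -> R) (l : nat) x : 'cV[R]_n :=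
  if l is l'.+1 then
    iter l' (mulmx (Jac1 x)) (Jac0 x *m grad c x - Jac1 x *m (Jac0 x *m grad c x))
  else grad c x - Jac0 x *m grad c x.

(** The expansion of the gradient into homogeneous parts needs no Taylor
    remainder: the parts telescope, and what is left is the explicit term with L
    factors Jac1, each of which vanishes at the foot of the ray. *)
Lemma grad_telescope c L x :
  grad c x = \sum_(l < L.+1) grad_part c l x + iter L (mulmx (Jac1 x)) (Jac0 x *m grad c x).
Proof.
elim: L => [|L IH]; first by rewrite big_ord1 /= subrK.
by rewrite big_ord_recr -addrA /= -iterS iterSr -iter_mulmxDl subrK.
Qed.

Lemma grad_part_homogeneous c k l i : smooth_open V c -> homogeneous k c ->
  homogeneous (k - 1 + l%:Z) (fun x => grad_part c l x i 0).
Proof.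
move=> sc hc x s Vx s0 sr.
have sn0 : s != 0 by rewrite gt_eqF.
have [K1 K2] := Jac_key Vx s0 sr.
have G := grad_ray sc hc Vx s0 sr.
set N := Jac (ray s x) in K1 K2 G.
have J0G : Jac0 x *m grad c (ray s x) =
    s ^ (k - 1) *: (Jac0 x *m grad c x + (s - 1) *: (N *m grad c x)).
  rewrite G -scalemxAr mulmxA mulmxDr mulmx1 -scalemxAr K1.
  by rewrite mulmxDl -scalemxAl.
case: l => [|l].
  suff -> : grad_part c 0 (ray s x) = s ^ (k - 1 + 0) *: grad_part c 0 x by rewrite mxE.
  rewrite /= Jac0_ray// J0G G addr0 -scalerBr; congr (_ *: _).
  by rewrite mulmxDl mul1mx -scalemxAl opprD addrACA subrr addr0.
suff -> : grad_part c l.+1 (ray s x) = s ^ (k - 1 + l.+1%:Z) *: grad_part c l.+1 x.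
  by rewrite mxE.
rewrite /= Jac1_ray// Jac0_ray// iter_mulmxZ.
have -> : s ^ (k - 1 + l.+1%:Z) = s ^+ l * (s ^ (k - 1) * s).
  by rewrite expfzDr// mulrCA -exprSr.
rewrite -scalerA -[in RHS]iter_mulmx_scale; congr (_ *: iter _ _ _).
rewrite J0G; set Z := _ + _ *: _; set X := Jac0 x *m grad c x.
have -> : (s *: Jac1 x) *m (s ^ (k - 1) *: Z) = s ^ (k - 1) *: (s *: (Jac1 x *m Z)).
  by rewrite -scalemxAl -scalemxAr !scalerA mulrC.
rewrite -scalerBr -[RHS]scalerA; congr (_ *: _).
have sJN : s *: (Jac1 x *m (N *m grad c x)) = N *m grad c x - Jac0 x *m grad c x.
  by rewrite -K2 mulmxBl mul1mx mulmxBl -scalemxAl -scalemxAl mulmxA subKr.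
have -> : s *: (Jac1 x *m Z) = s *: (Jac1 x *m X) + (s - 1) *: (N *m grad c x - X).
  rewrite mulmxDr scalerDr -scalemxAr [s *: (_ *: _)]scalerA mulrC -scalerA.
  by congr (_ + _ *: _); exact: sJN.
rewrite /Z -/X; move: X (Jac1 x *m X) (N *m grad c x) => X A Y.
apply/matrixP => a b; rewrite !mxE.
have alg (p q u : R) : p + (s - 1) * q - (s * u + (s - 1) * (q - p)) = s * (p - u).
  by ring.
exact: alg.
Qed.

(** The derivative at t = 1 of c (ray t x) = t^k c x. *)
Lemma homogeneous_euler c k x : smooth_open V c -> homogeneous k c -> V x ->
  \sum_(i < n) (x - pi x) 0 i * partial i c x = k%:~R * c x.
Proof.
move=> sc hc Vx; have rx := rho_gt0 Vx; have rr := rho_ltr Vx.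
have dc : differentiable c (pi x + 1 *: (x - pi x)).
  by rewrite -/(ray 1 x) ray1; exact: smooth_diff sc Vx.
have D1 := is_derive_line dc.
have D2 : is_derive (1 : R) 1 (fun s : R => c (pi x + s *: (x - pi x))) (k%:~R * c x).
  have D3 := is_deriveM (is_derive_exprz R k) (is_derive_cst (c x) (1 : R) (1 : R)).
  have -> : k%:~R * c x = 1 ^ k *: 0 + cst (c x) (1 : R) *: (k%:~R : R).
    by rewrite scaler0 add0r mulrC.
  apply: near_eq_is_derive D3.
  have r1 : 1 < r / rho x by rewrite ltr_pdivlMr ?mul1r.
  near=> s; rewrite -/(ray s x) hc//.
    by near: s; exact: lt_nbhsr.
  rewrite -ltr_pdivlMr//; near: s; exact: lt_nbhsl.
have := derive_val (is_derive := D2); rewrite (derive_val (is_derive := D1)).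
by rewrite -/(ray 1 x) ray1 deriveE ?diff_partials//; exact: smooth_diff sc Vx.
Unshelve. all: by end_near. Qed.

End rays.

(** * Orders of growth at a submanifold *)

Section euclidean_norm.
Variables (R : realType) (n : nat).
Implicit Types x : 'rV[R]_n.

Lemma dot_ge0 x : 0 <= dot x x.
Proof. by apply: sumr_ge0 => i _; rewrite -expr2 sqr_ge0. Qed.

Lemma enorm_ge0 x : 0 <= enorm x. Proof. exact: sqrtr_ge0. Qed.

Lemma enorm_sq x : enorm x * enorm x = dot x x.
Proof. by rewrite -expr2 sqr_sqrtr// dot_ge0. Qed.

Lemma coord_le_enorm x i : `|x 0 i| <= enorm x.
Proof.
rewrite -sqrtr_sqr ler_sqrt ?sqr_ge0// ?dot_ge0//.
by rewrite /dot (bigD1 i)//= -expr2 lerDl sumr_ge0// => j _; rewrite -expr2 sqr_ge0.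
Qed.

Lemma norm_le_enorm x : `|x| <= enorm x.
Proof.
rewrite {1}/Num.Def.normr /= mx_normrE; apply: bigmax_le; first exact: enorm_ge0.
by move=> [a b] _ /=; rewrite (ord1 a); exact: coord_le_enorm.
Qed.

Lemma enormZ (t : R) x : 0 <= t -> enorm (t *: x) = t * enorm x.
Proof.
move=> t0; rewrite /enorm.
have -> : dot (t *: x) (t *: x) = t ^+ 2 * dot x x.
  by rewrite /dot mulr_sumr; apply: eq_bigr => i _; rewrite !mxE mulrACA expr2.
by rewrite sqrtrM ?sqr_ge0// sqrtr_sqr ger0_norm.
Qed.

Lemma enorm_eq0 x : enorm x = 0 -> x = 0.
Proof.
move=> x0; apply/eqP; rewrite -normr_le0 -x0; exact: norm_le_enorm.
Qed.

End euclidean_norm.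

Lemma compact_uniform (X : topologicalType) (Q : set X) (P : nat -> X -> Prop) :
  compact Q -> (forall M N x, (M <= N)%N -> P M x -> P N x) ->
  (forall p, Q p -> exists M, \forall x \near p, P M x) ->
  exists M, forall x, Q x -> P M x.
Proof.
move=> /compact_near_coveringP cQ mono loc.
have [M _ h] : \forall M \near \oo, Q `<=` P M.
  apply: (cQ nat \oo P) => p /loc[M hM].
  exists ([set x | P M x], [set i | (M <= i)%N]) => /=.
    by split=> //; exact: nbhs_infty_ge.
  by move=> [x i] /= [Px Mi]; exact: mono Px.
by exists M => x Qx; exact: (h M (leqnn M)).
Qed.

Section tube_bounds.
Variables (R : realType) (n : nat).
Variables (Sigma T : set 'rV[R]_n) (pi : 'rV[R]_n -> 'rV[R]_n).

(** T is an open neighbourhood of Sigma with its nearest-point projection; it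
    will be the union of the charts. *)
Record tube_retraction : Prop := TubeRetraction {
  retraction_closed : closed Sigma;
  retraction_open : open T;
  retraction_sub : Sigma `<=` T;
  retraction_smooth : smooth_open T pi;
  retraction_onto : forall x, T x -> Sigma (pi x);
  retraction_id : forall x, Sigma x -> pi x = x }.

Hypothesis tb : tube_retraction.
Let cS := retraction_closed tb.
Let oT := retraction_open tb.
Let ST := retraction_sub tb.
Let spi := retraction_smooth tb.
Let piS := retraction_onto tb.
Local Notation rho := (tube_rho pi).

Lemma tube_rho_gt0 x : T x -> ~ Sigma x -> 0 < rho x.
Proof.
move=> Tx nS; rewrite lt_neqAle enorm_ge0 andbT; apply/eqP => /esym/enorm_eq0/subr0_eq E.
by apply: nS; rewrite E; exact: piS.
Qed.

(** An estimate for small rho is vacuous near such a point: this is how the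
    compactness arguments treat the points outside Sigma. *)
Lemma away_from_Sigma p : ~ Sigma p -> exists M : nat,
  \forall x \near p, T x -> M.+1%:R^-1 <= rho x.
Proof.
move=> nS.
have : \forall x \near p, ~ Sigma x.
  by apply: open_near (closed_openC cS) nS _.
move=> /nbhs_ballP[e /= e0 he].
have e20 : 0 < e / 2 by rewrite divr_gt0.
have [M hM] : exists M : nat, M.+1%:R^-1 < e / 2.
  have [M _ h] := @near_infty_natSinv_lt R (PosNum e20).
  by exists M; exact: (h M (leqnn M)).
exists M; near=> x => Tx; apply: ltW; apply: lt_le_trans hM _.
rewrite leNgt; apply/negP => rx.
apply: (he (pi x)); last exact: piS.
rewrite -ball_normE /ball_ /=.
apply: le_lt_trans (ler_distD x _ _) _; rewrite [ltRHS](splitr e).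
apply: ltrD.
  near: x; exact: cvgr_dist_lt.
exact: le_lt_trans (norm_le_enorm _) rx.
Unshelve. all: by end_near. Qed.

Lemma smooth_pi_comp (F : 'rV[R]_n -> R) : smooth_open T F -> smooth_open T (F \o pi).
Proof.
move=> sF k; apply: (Ck_comp (rV_coordinates R n) oT _ (sF k) (spi k)).
by move=> x Tx; apply: ST; exact: piS.
Qed.

Variable D : set 'rV[R]_n.

(** A bounded region off Sigma on which the orders of growth at Sigma are
    measured. Smoothness of rho belongs to the data because it is obtained from
    polar coordinates. *)
Record collar : Prop := Collar {
  collar_open : open D;
  collar_sub : D `<=` T;
  collar_off : forall x, D x -> ~ Sigma x;
  collar_compact : exists2 Q, compact Q & D `<=` Q;
  collar_rho : smooth_open D rho }.

Hypothesis co : collar.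
Let oD := collar_open co.
Let DT := collar_sub co.
Let DnS := collar_off co.
Let srho := collar_rho co.

Lemma collar_gt0 x : D x -> 0 < rho x.
Proof. by move=> Dx; apply: tube_rho_gt0; [exact: DT|exact: DnS]. Qed.
Let rho_gt0 := collar_gt0.

(** The closure of D may leave T, where F is not controlled, but it does so away
    from Sigma, hence at a positive distance rho. *)
Lemma isO_continuous (F : 'rV[R]_n -> R) : (forall x, T x -> {for x, continuous F}) ->
  isO_on D rho 0 F.
Proof.
move=> cF; have [Q cQ DQ] := collar_compact co.
pose P (M : nat) x := D x -> rho x < M.+1%:R^-1 -> `|F x| <= M%:R.
have [M hM] : exists M, forall x, Q x -> P M x.
  apply: compact_uniform => //.
    move=> M N x MN h Dx xN; apply: le_trans (_ : M%:R <= _); last by rewrite ler_nat.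
    apply: h => //; apply: lt_le_trans xN _.
    by rewrite lef_pV2 ?posrE ?ltr0n// ler_nat.
  move=> p Qp; have [Sp|/away_from_Sigma[M hM]] := pselect (Sigma p).
    have [M hM] : exists M : nat, `|F p| + 1 < M%:R.
      exists (Num.bound (`|F p| + 1)); apply: archi_boundP.
      by rewrite addr_ge0.
    exists M; have := cF p (ST Sp); move/cvgrPdist_lt => /(_ 1 ltr01).
    apply: filterS => x hx _ _; apply: ltW; apply: le_lt_trans hM.
    rewrite -lerBlDl; apply: le_trans (lerB_dist _ _) _.
    by rewrite distrC; exact: ltW.
  exists M; apply: filterS hM => x hx Dx; rewrite ltNge => /negP; case.
  by apply: hx; exact: DT.
exists M%:R, M.+1%:R^-1; split; first by rewrite invr_gt0 ltr0n.
move=> x Dx xM; rewrite expr0z mulr1; apply: (hM x) => //; exact: DQ.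
Qed.

Lemma symb_smooth b (F : 'rV[R]_n -> R) : smooth_open T F -> symb_on D rho b 0 F.
Proof.
elim: b F => [|b IH] F sF.
  by split=> //; apply: isO_continuous => x Tx; exact: smooth_cont sF Tx.
split=> [|i]; first by apply: isO_continuous => x Tx; exact: smooth_cont sF Tx.
apply: (@symb_le _ _ _ _ rho_gt0 b 0); first by lia.
by apply: IH; exact: smooth_partial.
Qed.

Lemma smooth_offset j : smooth_open T (fun x => (x - pi x) 0 j).
Proof.
have h := smoothB oT (smooth_entry j oT (smooth_id oT)) (smooth_entry j oT spi).
by apply: smooth_ext h => // x _; rewrite !mxE.
Qed.

Lemma symb_offset b j : symb_on D rho b 1 (fun x => (x - pi x) 0 j).
Proof.
have O1 : isO_on D rho 1 (fun x => (x - pi x) 0 j).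
  exists 1, 1; split=> // x Dx _; rewrite expr1z mul1r; exact: coord_le_enorm.
case: b => [|b]; split=> // i.
by apply: symb_smooth; apply: smooth_partial => //; exact: smooth_offset.
Qed.

Let rho_neq0 x : D x -> rho x != 0.
Proof. by move=> Dx; rewrite gt_eqF// rho_gt0. Qed.

Let smD (F : 'rV[R]_n -> R) : smooth_open T F -> smooth_open D F.
Proof. exact: smooth_sub. Qed.

Lemma smooth_rhoV : smooth_open D (fun x => (rho x)^-1).
Proof. exact: smoothV. Qed.

Lemma rho_sq x : rho x * rho x = \sum_(j < n) (x - pi x) 0 j * (x - pi x) 0 j.
Proof. exact: enorm_sq. Qed.

(** Obtained by differentiating the sum of squares for rho * rho and the relation
    rho * rho^-1 = 1. The derivative is again a product of powers of rho^-1 and of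
    functions of known order, which makes [symb_rhoV] an induction. *)
Lemma partial_rhoV i x : D x -> partial i (fun y => (rho y)^-1) x =
  - (\sum_(j < n) (x - pi x) 0 j * partial i (fun y => (y - pi y) 0 j) x) *
    ((rho x)^-1 * ((rho x)^-1 * (rho x)^-1)).
Proof.
move=> Dx.
have dr := smooth_diff srho Dx; have dz := smooth_diff smooth_rhoV Dx.
have so j : smooth_open D (fun y => (y - pi y) 0 j) by exact/smD/smooth_offset.
have soo j := smoothM oD (so j) (so j).
have E1 : partial i (rho * rho) x =
    \sum_(j < n) (partial i (fun y => (y - pi y) 0 j) x * (x - pi x) 0 j +
                  (x - pi x) 0 j * partial i (fun y => (y - pi y) 0 j) x).
  rewrite (partial_ext (g := fun y => \sum_(j < n)
    ((fun y => (y - pi y) 0 j) * (fun y => (y - pi y) 0 j)) y) i oD Dx); last first.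
    by move=> y _; exact: rho_sq.
  rewrite (partial_as_dpartial i) (dpartial_sum oD _ soo)//; apply: eq_bigr => j _.
  by rewrite -partial_as_dpartial partialM//; exact: smooth_diff (so j) Dx.
have E2 : partial i (rho * (fun y => (rho y)^-1)) x = 0.
  rewrite (partial_ext (g := cst 1) i oD Dx) ?partial_cst// => y Dy.
  exact: (divff (rho_neq0 Dy)).
rewrite (partialM i dr dr) in E1; rewrite (partialM i dr dz) in E2.
have E1' : partial i rho x * rho x =
    \sum_(j < n) (x - pi x) 0 j * partial i (fun y => (y - pi y) 0 j) x.
  have two : (2 : R) != 0 by rewrite pnatr_eq0.
  apply: (mulfI two); rewrite mulr_sumr.
  transitivity (partial i rho x * rho x + rho x * partial i rho x).
    by rewrite mulr_natl mulr2n; congr (_ + _); exact: mulrC.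
  rewrite E1; apply: eq_bigr => j _.
  by rewrite mulr_natl mulr2n; congr (_ + _); exact: mulrC.
rewrite -E1'; have := rho_neq0 Dx; move: E2.
move: (partial i (fun y => (rho y)^-1) x) (partial i rho x) (rho x) => z' r' r E2 r0.
apply: (mulfI r0); move/eqP : E2; rewrite addrC addr_eq0 => /eqP ->.
by field.
Qed.

Lemma symb_rhoV b : symb_on D rho b (-1) (fun x => (rho x)^-1).
Proof.
have O1 : isO_on D rho (-1) (fun x => (rho x)^-1).
  exists 1, 1; split=> // x Dx _; rewrite mul1r ger0_norm// invr_ge0 ltW//.
  exact: rho_gt0.
have sz := smooth_rhoV.
elim: b => [|b IH]; split=> // i.
pose z := fun x => (rho x)^-1.
pose u := fun x => \sum_(j < n) (x - pi x) 0 j * partial i (fun y => (y - pi y) 0 j) x.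
have so j : smooth_open D (fun y => (y - pi y) 0 j) by exact/smD/smooth_offset.
have sp j : smooth_open T (partial i (fun y => (y - pi y) 0 j)).
  by apply: smooth_partial => //; exact: smooth_offset.
have st j := smoothM oD (so j) (smD (sp j)).
have su : smooth_open D u := smooth_sum oD st.
have zu : symb_on D rho b 1 u.
  apply: (symb_sum oD st) => j.
  have h := symbM oD rho_gt0 (so j) (smD (sp j)) (symb_offset b j) (symb_smooth b (sp j)).
  by rewrite addr0 in h.
have zzz := symbM oD rho_gt0 sz (smoothM oD sz sz) IH (symbM oD rho_gt0 sz sz IH IH).
have := symbM oD rho_gt0 (smoothN oD su) (smoothM oD sz (smoothM oD sz sz))
  (symbN oD rho_gt0 su zu) zzz.
have -> : (1 + (-1 + (-1 + -1)) : int) = -1 - 1 by [].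
apply: symb_ext => // x Dx; exact: esym (partial_rhoV i Dx).
Qed.

Lemma symb_rho b : symb_on D rho b 1 rho.
Proof.
have so j : smooth_open D (fun y => (y - pi y) 0 j) by exact/smD/smooth_offset.
have st j := smoothM oD (so j) (so j).
have h : symb_on D rho b 2 (fun x => \sum_(j < n)
    ((fun y => (y - pi y) 0 j) * (fun y => (y - pi y) 0 j)) x).
  apply: (symb_sum oD st) => j.
  exact: (symbM oD rho_gt0 (so j) (so j) (symb_offset b j) (symb_offset b j)).
have := symbM oD rho_gt0 (smooth_sum oD st) smooth_rhoV h (symb_rhoV b).
apply: symb_ext => // x Dx.
exact: (etrans (congr1 (fun s => s * (rho x)^-1) (esym (rho_sq x))) (mulfK (rho_neq0 Dx) _)).
Qed.

Lemma smooth_rhoX (k : int) : smooth_open D (fun x => rho x ^ k).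
Proof. exact: smooth_exprz. Qed.

Lemma symb_rhoX b (k : int) : symb_on D rho b k (fun x => rho x ^ k).
Proof.
have pos w (f : 'rV[R]_n -> R) : smooth_open D f -> symb_on D rho b w f -> forall j : nat,
    smooth_open D (fun x => f x ^+ j) /\ symb_on D rho b (w * j%:Z) (fun x => f x ^+ j).
  move=> sf hf; elim=> [|j [s IH]].
    split; first exact: (smooth_cst D 1).
    by rewrite mulr0; exact: (symb_cst rho oD b 1).
  split.
    apply: smooth_ext (smoothM oD sf s) => // x _.
    by rewrite exprS.
  rewrite (_ : w * j.+1%:Z = w + w * j%:Z); last by lia.
  apply: symb_ext (symbM oD rho_gt0 sf s hf IH) => // x _.
  by rewrite exprS.
case: k => k.
  by have [_] := pos 1 _ srho (symb_rho b) k; rewrite mul1r.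
have [_] := pos (-1) _ smooth_rhoV (symb_rhoV b) k.+1.
rewrite (_ : -1 * k.+1%:Z = Negz k); last by lia.
by apply: symb_ext => // x _; rewrite exprVn.
Qed.

(** The chain rule: a derivative of the composite is a sum of derivatives of g,
    of order -1, times composites of the same kind. *)
Lemma symb_comp (V : set 'rV[R]_n) (g : 'rV[R]_n -> 'rV[R]_n) :
  open V -> (forall x, D x -> V (g x)) -> (forall j, smooth_open D (fun x => g x 0 j)) ->
  (forall b j, symb_on D rho b 0 (fun x => g x 0 j)) ->
  (forall F : 'rV[R]_n -> R, smooth_open V F -> isO_on D rho 0 (F \o g)) ->
  forall b (F : 'rV[R]_n -> R), smooth_open V F ->
    smooth_open D (F \o g) /\ symb_on D rho b 0 (F \o g).
Proof.
move=> oV gV sg hg bg.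
have sgv := smooth_vec oD sg.
have sc (F : 'rV[R]_n -> R) : smooth_open V F -> smooth_open D (F \o g).
  by move=> sF k; exact: (Ck_comp (rV_coordinates R n) oD gV (sF k) (sgv k)).
elim=> [|b IH] F sF; first by split; [exact: sc|split=> //; exact: bg].
split; first exact: sc.
split=> [|i]; first exact: bg.
have sFj j := smooth_partial j oV sF.
have h j : symb_on D rho b (-1) (partial i (fun x => g x 0 j) * (partial j F \o g)).
  have [_ /(_ i) h1] := hg b.+1 j; rewrite sub0r in h1.
  have [h2 h3] := IH _ (sFj j).
  have := symbM oD rho_gt0 (smooth_partial i oD (sg j)) h2 h1 h3.
  by rewrite addr0.
have st j : smooth_open D (partial i (fun x => g x 0 j) * (partial j F \o g)).
  by apply: smoothM => //; [exact: smooth_partial|have [] := IH _ (sFj j)].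
have := symb_sum oD st h; rewrite sub0r.
apply: symb_ext => // x Dx.
rewrite partial_comp//; first exact: smooth_diff sgv Dx.
by apply: smooth_diff sF _; exact: gV.
Qed.

End tube_bounds.

(** * Separation of homogeneous terms *)

Section separation.
Variables (R : realType) (n : nat).
Variables (Sigma T : set 'rV[R]_n) (pi : 'rV[R]_n -> 'rV[R]_n).
Variable D : set 'rV[R]_n.
Hypotheses (tb : tube_retraction Sigma T pi) (co : collar Sigma T pi D).
Let oT := retraction_open tb.
Let spi := retraction_smooth tb.
Let oD := collar_open co.
Let DT := collar_sub co.
Let rho_gt0 := collar_gt0 tb co.
Local Notation rho := (tube_rho pi).
Local Notation sm := (smooth_open D).
Local Notation symb := (symb_on D rho).

(** The radial field rho d/drho. *)
Definition euler (f : 'rV[R]_n -> R) (x : 'rV[R]_n) : R :=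
  \sum_(i < n) (x - pi x) 0 i * partial i f x.

Let so j : sm (fun x => (x - pi x) 0 j).
Proof. by apply: (smooth_sub DT); exact: (smooth_offset tb). Qed.

Lemma smooth_euler f : sm f -> sm (euler f).
Proof.
move=> sf; have st i := smoothM oD (so i) (smooth_partial i oD sf).
exact: (smooth_sum oD st : smooth_open D (euler f)).
Qed.

Lemma symb_euler b w f : sm f -> symb b.+1 w f -> symb b w (euler f).
Proof.
move=> sf [_ h].
have st i := smoothM oD (so i) (smooth_partial i oD sf).
suff h1 i : symb b w ((fun x => (x - pi x) 0 i) * partial i f).
  exact: (symb_sum oD st h1 : symb b w (euler f)).
have so1 : symb b 1 (fun x => (x - pi x) 0 i).
  exact: (symb_offset tb co).
have := symbM oD rho_gt0 (so i) (smooth_partial i oD sf) so1 (h i).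
by rewrite addrC subrK.
Qed.

Lemma smooth_sum_seq (s : seq nat) (c : nat -> 'rV[R]_n -> R) :
  (forall k, sm (c k)) -> sm (fun x => \sum_(k <- s) c k x).
Proof.
move=> sc; elim: s => [|k s IH].
  by apply: smooth_ext (smooth_cst D 0) => // x _; rewrite big_nil.
by apply: smooth_ext (smoothD oD (sc k) IH) => // x _; rewrite big_cons.
Qed.

Lemma symb_sum_seq b w (s : seq nat) (c : nat -> 'rV[R]_n -> R) :
  (forall k, sm (c k)) -> (forall k, k \in s -> symb b w (c k)) ->
  symb b w (fun x => \sum_(k <- s) c k x).
Proof.
move=> sc; elim: s => [|k s IH] h.
  by apply: symb_ext (symb_0 rho oD b w) => // x _; rewrite big_nil.
apply: symb_ext (symbD oD (sc k) (smooth_sum_seq s sc) (h k (mem_head _ _)) (IH _)) => //.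
  by move=> x _; rewrite big_cons.
by move=> j js; apply: h; rewrite inE js orbT.
Qed.

Lemma euler_sum_seq (s : seq nat) (c : nat -> 'rV[R]_n -> R) :
  (forall k, sm (c k)) -> forall x, D x ->
  euler (fun x => \sum_(k <- s) c k x) x = \sum_(k <- s) euler (c k) x.
Proof.
move=> sc x Dx; elim: s => [|k s IH].
  rewrite big_nil /euler big1// => i _.
  rewrite (partial_ext (g := cst 0) i oD Dx) ?partial_cst ?mulr0// => y _.
  by rewrite big_nil.
rewrite big_cons -IH /euler -big_split; apply: eq_bigr => i _ /=.
rewrite -mulrDr; congr (_ * _).
rewrite (partial_ext (g := c k + (fun x => \sum_(k <- s) c k x)) i oD Dx).
  by rewrite partialD//; [exact: smooth_diff (sc k) Dx|exact: smooth_diff (smooth_sum_seq s sc) Dx].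
by move=> y _; rewrite big_cons.
Qed.

(** The Euler field multiplies a term of degree k by k, so that applying
    euler - k to a finite sum removes that term and keeps the others up to
    nonzero factors: the terms can be recovered from the sum, at the cost of one
    derivative per term. The terms of t are controlled beforehand and cost nothing;
    this matters because their number depends on how many derivatives the terms
    of s cost. *)
Lemma separate_degrees b (m w : int) (s t : seq nat) (c : nat -> 'rV[R]_n -> R) :
  uniq s -> (forall k, sm (c k)) ->
  (forall k x, D x -> euler (c k) x = (m + k%:Z)%:~R * c k x) ->
  (forall k, k \in t -> symb b w (c k)) ->
  symb (b + size s) w (fun x => \sum_(k <- s ++ t) c k x) ->
  forall k, k \in s -> symb b w (c k).
Proof.
elim: s c => [//|k0 s IH] c /= /andP[k0s us] sc Ec tc.
set total := fun x => _; rewrite addnS => htot.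
have stot : sm total by exact: (smooth_sum_seq (k0 :: s ++ t)).
pose a (k : nat) : R := (m + k%:Z)%:~R - (m + k0%:Z)%:~R.
have aE k : a k = (k%:Z - k0%:Z)%:~R by rewrite /a -intrB; congr (_%:~R); lia.
pose c' k := fun x => a k * c k x.
have sc' k : sm (c' k) by apply: smoothZ.
have Ec' k x : D x -> euler (c' k) x = (m + k%:Z)%:~R * c' k x.
  move=> Dx; rewrite /c' mulrCA -Ec// /euler mulr_sumr; apply: eq_bigr => i _.
  rewrite mulrCA; congr (_ * _).
  rewrite (partialM i (differentiable_cst (a k) x) (smooth_diff (sc k) Dx)).
  by rewrite partial_cst mul0r add0r.
have tc' k : k \in t -> symb b w (c' k) by move=> /tc h; exact: symbZ.
have htot' : symb (b + size s) w (fun x => \sum_(k <- s ++ t) c' k x).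
  have h1 := symb_euler stot htot.
  have h2 := symbZ oD rho_gt0 (m + k0%:Z)%:~R stot (symb_weak htot).
  have := symbB oD rho_gt0 (smooth_euler stot) (smoothZ oD _ stot) h1 h2.
  apply: symb_ext => // x Dx.
  transitivity (euler total x - (m + k0%:Z)%:~R * total x); first by [].
  have -> : euler total x = \sum_(k <- k0 :: s ++ t) euler (c k) x.
    exact: (euler_sum_seq (k0 :: s ++ t) sc Dx).
  rewrite (_ : total x = \sum_(k <- k0 :: s ++ t) c k x)//.
  rewrite mulr_sumr -sumrB big_cons Ec// subrr add0r.
  by apply: eq_bigr => k _; rewrite Ec// -mulrBl.
have hs k : k \in s -> symb b w (c k).
  move=> ks; have hk := IH _ us sc' Ec' tc' htot' k ks.
  have ak : a k != 0.
    rewrite aE intr_eq0 subr_eq0; apply: contraNneq k0s => -[<-].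
    exact: ks.
  apply: symb_ext (symbZ oD rho_gt0 (a k)^-1 (sc' k) hk) => // x Dx.
  by rewrite /c' mulKf.
move=> k; rewrite inE => /orP[/eqP -> |]; last exact: hs.
have hst : symb b w (fun x => \sum_(k <- s ++ t) c k x).
  apply: symb_sum_seq => // j; rewrite mem_cat => /orP[]; [exact: hs|exact: tc].
have htb : symb b w total by apply: symb_weaken htot; lia.
apply: symb_ext (symbB oD rho_gt0 stot (smooth_sum_seq (s ++ t) sc) htb hst) => // x Dx.
transitivity (total x - \sum_(k <- s ++ t) c k x); first by [].
rewrite (_ : total x = \sum_(k <- k0 :: s ++ t) c k x)// big_cons.
exact: addrK.
Qed.

End separation.

Lemma smooth_on_open (R : realType) (V W : normedModType R) (A : set V) (f : V -> W) :
  open A -> smooth_on A f -> smooth_open A f.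
Proof.
move=> oA h k; apply: Ck_local => x Ax.
have [B [F [oB Bx sF FE]]] := h x Ax.
exists (B `&` A); first by split.
apply: (Ck_ext (f := F)); first exact: openI.
  by move=> y [By Ay]; exact: FE.
exact: Ck_sub (sF k).
Qed.

(** * Polar charts *)

Section polar_chart.
Variables (R : realType) (n d : nat).
Variables (Sigma T U : set 'rV[R]_n) (pi : 'rV[R]_n -> 'rV[R]_n).
Variables (nu : 'I_d -> 'rV[R]_n -> 'rV[R]_n) (r : R).
Hypothesis tb : tube_retraction Sigma T pi.
Hypotheses (oU : open U) (UT : U `<=` T) (r0 : 0 < r).
Local Notation V := (U `\` Sigma).
Local Notation A := (((Sigma `&` U) `*` @sphere R d) `*` `]0, r[).
Hypothesis polar : diffeo A V (polar_map nu) (polar_coords pi nu).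
Local Notation rho := (tube_rho pi).
Local Notation omega := (tube_omega pi nu).

Lemma polar_open : open V.
Proof. by rewrite setDE; apply: openI => //; exact/closed_openC/(retraction_closed tb). Qed.

Lemma polar_mem x : V x -> [/\ Sigma (pi x), U (pi x), sphere (omega x), 0 < rho x & rho x < r].
Proof.
have [_ _ _ h] := polar.
move=> /h[[[[/= ? ?] ?]]]; rewrite in_itv /= => /andP[? ?] _.
by split.
Qed.

Lemma polar_segment q (t : R) : (Sigma `&` U) q.1 -> sphere q.2 -> 0 < t -> t < r ->
  V (polar_map nu (q, t)) /\ polar_coords pi nu (polar_map nu (q, t)) = (q, t).
Proof.
have [_ _ h _] := polar; move=> Sq sq t0 tr; apply: h.
by split=> //=; rewrite in_itv /= t0.
Qed.

Lemma ray_polar x t : V x -> ray pi t x = polar_map nu (pi x, omega x, t * rho x).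
Proof.
move=> Vx; have [_ _ _ /(_ x Vx)[_ E]] := polar.
rewrite /ray -{2}E /polar_map /= -scalerA; congr (_ + _ *: _).
by rewrite addrC addKr.
Qed.

Lemma polar_ray x t : V x -> 0 < t -> t * rho x < r ->
  [/\ V (ray pi t x), pi (ray pi t x) = pi x, omega (ray pi t x) = omega x &
      rho (ray pi t x) = t * rho x].
Proof.
move=> Vx t0 tr; have [Sp Up sw p0 pr] := polar_mem Vx.
have [] := @polar_segment (pi x, omega x) (t * rho x) (conj Sp Up) sw _ tr.
  exact: mulr_gt0.
by rewrite -ray_polar// => Vr [-> -> ->].
Qed.

Lemma smooth_polar_coords : smooth_open V (polar_coords pi nu).
Proof.
by have [_ h _ _] := polar; apply: smooth_on_open => //; exact: polar_open.
Qed.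

Lemma smooth_rho_chart : smooth_open V rho.
Proof.
move=> k; have := Ck_lin_comp polar_open
  (@psnd_continuous R ('rV[R]_n * 'rV[R]_d)%type R) (smooth_polar_coords k).
exact.
Qed.

Lemma smooth_angle : smooth_open V (fun x => (pi x, omega x)).
Proof.
move=> k; have := Ck_lin_comp polar_open
  (@pfst_continuous R ('rV[R]_n * 'rV[R]_d)%type R) (smooth_polar_coords k).
exact.
Qed.

Lemma chart_radial : radial_region V T pi r.
Proof.
split.
- exact: polar_open.
- exact: retraction_open tb.
- exact: retraction_smooth tb.
- by move=> x [/UT].
- by move=> x /polar_mem[_ /UT].
- by move=> x /polar_mem[].
- by move=> x /polar_mem[].
- by move=> x t Vx t0 tr; have [] := polar_ray Vx t0 tr.
- by move=> x t Vx t0 tr; have [] := polar_ray Vx t0 tr.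
- by move=> x t Vx t0 tr; have [] := polar_ray Vx t0 tr.
- by move=> x Vx; exact: smooth_cont smooth_rho_chart Vx.
Qed.

Let rho_neq0 x : V x -> rho x != 0.
Proof. by move=> /polar_mem[_ _ _ h _]; rewrite gt_eqF. Qed.

Definition polar_term (a : 'rV[R]_n * 'rV[R]_d -> R) (k : int) (x : 'rV[R]_n) : R :=
  a (pi x, omega x) * rho x ^ k.

Lemma smooth_polar_term a k : smooth_on ((Sigma `&` U) `*` @sphere R d) a ->
  smooth_open V (polar_term a k).
Proof.
move=> sa; have oV := polar_open.
have s1 : smooth_open V (fun x => a (pi x, omega x)).
  move=> j; apply: Ck_local => x Vx.
  have [Sp Up sw _ _] := polar_mem Vx.
  have [B [F [oB Bx sF FE]]] := sa (pi x, omega x) (conj (conj Sp Up) sw).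
  pose g y := (pi y, omega y).
  have oVB : open (V `&` g @^-1` B).
    rewrite openE => y [Vy By]; rewrite /interior; apply: filterI.
      exact: open_nbhs_nbhs.
    apply: (smooth_cont smooth_angle Vy); exact: open_nbhs_nbhs.
  exists (V `&` g @^-1` B); first by split.
  apply: (Ck_ext (f := F \o g)) => //.
    move=> y [Vy By]; apply: FE => //.
    by have [? ? ? _ _] := polar_mem Vy.
  apply: (Ck_comp (prod_coordinates (rV_coordinates R n) (rV_coordinates R d)) _ _ (sF j)) => //.
    by move=> y [].
  by apply: Ck_sub (smooth_angle j) => y [].
have sr : smooth_open V (fun x => rho x ^ k) by exact: smooth_exprz smooth_rho_chart.
exact: (smoothM oV s1 sr).
Qed.

Lemma homogeneous_polar_term a k : homogeneous V pi r k (polar_term a k).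
Proof.
move=> x t Vx t0 tr; have [_ Ep Eo Er] := polar_ray Vx t0 tr.
by rewrite /polar_term Ep Eo Er expfzMl mulrCA.
Qed.

(** A homogeneous function is determined by its values at distance r / 2 from
    Sigma; a is that restriction, read in polar coordinates and rescaled. *)
Lemma homogeneous_polar h k : smooth_open V h -> homogeneous V pi r k h ->
  exists2 a, smooth_on ((Sigma `&` U) `*` @sphere R d) a &
    forall x, V x -> h x = polar_term a k x.
Proof.
move=> sh hh; have oV := polar_open.
have r20 : 0 < r / 2 by rewrite divr_gt0.
have r2r : r / 2 < r by rewrite ltr_pdivrMr// ltr_pMr// ltr1n.
pose a q := (r / 2) ^ (- k) * h (polar_map nu (q, r / 2)).
exists a.
  move=> q [Sq sq].
  have [sp _ _ _] := polar.
  have Aq q' : (Sigma `&` U) q'.1 -> sphere q'.2 -> A (q', r / 2).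
    by move=> S' s'; split=> //=; rewrite in_itv /= r20.
  have [B [G [oB Bq sG GE]]] := sp (q, r / 2) (Aq q Sq sq).
  pose L := @pinl R ('rV[R]_n * 'rV[R]_d)%type R.
  pose e : ('rV[R]_n * 'rV[R]_d) * R := (0, r / 2).
  have Le q' : L q' + e = (q', r / 2).
    by rewrite /L /pinl /e; congr pair; rewrite /= ?addr0 ?add0r.
  have cL : continuous L by exact: pinl_continuous.
  pose B1 := [set q' | B (L q' + e)].
  have oB1 : open B1.
    apply: (open_comp _ oB) => q' _; apply: continuousD; first exact: cL.
    exact: cst_continuous.
  have sG1 k' : Ck k' B1 (fun q' => G (L q' + e)) by exact: Ck_comp_affine.
  pose B2 := B1 `&` [set q' | V (G (L q' + e))].
  have oB2 : open B2.
    rewrite openE => y [By Vy]; rewrite /interior; apply: filterI.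
      exact: open_nbhs_nbhs.
    apply: (smooth_cont sG1 By); exact: open_nbhs_nbhs.
  exists B2, (fun q' => (r / 2) ^ (- k) * h (G (L q' + e))); split=> //.
  - split; rewrite /B1 /= Le// GE//; last exact: Aq.
    by have [] := polar_segment Sq sq r20 r2r.
  - apply: smoothZ => // k'.
    apply: (Ck_comp (rV_coordinates R n) oB2 _ (sh k')); first by move=> y [].
    by apply: Ck_sub (sG1 k') => y [].
  - move=> y [By _] [Sy sy]; rewrite /a Le GE//; first by move: By; rewrite /B1 /= Le.
    exact: Aq.
move=> x Vx; rewrite /polar_term /a.
have x0 : 0 < rho x by have [] := polar_mem Vx.
have E : polar_map nu (pi x, omega x, r / 2) = ray pi (r / 2 / rho x) x.
  by rewrite ray_polar// divfK ?rho_neq0.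
rewrite E hh ?divr_gt0// ?divfK ?rho_neq0//.
have E2 : (r / 2 / rho x) ^ k * rho x ^ k = (r / 2) ^ k.
  by rewrite -expfzMl divfK ?rho_neq0.
have E3 : (r / 2) ^ (- k) * (r / 2) ^ k = 1.
  by rewrite -expfzDr ?gt_eqF// addNr expr0z.
have alg (u p z q b : R) : p * q = b -> u * b = 1 -> z = u * (p * z) * q.
  by move=> <- e; rewrite -[LHS]mul1r -e; ring.
exact: alg E2 E3.
Qed.

(** [polar_map] is only known to agree, near each point and on the set where it is
    a chart, with a map that is smooth on an open set; so the compactness argument
    is run on Q rather than on its image. *)
Lemma polar_sphere_bounded (Q : set ('rV[R]_n * 'rV[R]_d)) F :
  compact Q -> Q `<=` (Sigma `&` U) `*` @sphere R d ->
  (forall x, V x -> {for x, continuous F}) ->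
  exists M : nat, forall q, Q q -> `|F (polar_map nu (q, r / 2)) : R| <= M%:R.
Proof.
move=> cQ QS cF.
have r20 : 0 < r / 2 by rewrite divr_gt0.
have r2r : r / 2 < r by rewrite ltr_pdivrMr// ltr_pMr// ltr1n.
pose P (M : nat) q := Q q -> `|F (polar_map nu (q, r / 2))| <= M%:R.
suff [M hM] : exists M, forall q, Q q -> P M q.
  by exists M => q Qq; exact: hM.
apply: compact_uniform => //.
  by move=> M N q MN h Qq; apply: le_trans (h Qq) _; rewrite ler_nat.
move=> q Qq.
have Aq q' : Q q' -> A (q', r / 2).
  by move=> /QS[S' s']; split=> //=; rewrite in_itv /= r20.
have [sp _ _ _] := polar.
have [B [G [oB Bq sG GE]]] := sp (q, r / 2) (Aq q Qq).
have GV : V (G (q, r / 2)).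
  rewrite GE//; last exact: Aq.
  by have [Sq sq] := QS q Qq; have [] := polar_segment Sq sq r20 r2r.
pose j (q' : 'rV[R]_n * 'rV[R]_d) : ('rV[R]_n * 'rV[R]_d) * R := (q', r / 2).
have cj : continuous j.
  have -> : j = fun q' => pinl R q' + (0, r / 2).
    by apply/funext => q'; rewrite /pinl; congr pair; rewrite /= ?addr0 ?add0r.
  move=> w; apply: continuousD; first exact: pinl_continuous.
  exact: cst_continuous.
have cGj : {for q, continuous (G \o j)}.
  exact: (@continuous_comp _ _ _ j G q (cj q) (smooth_cont sG Bq)).
have cFG : {for q, continuous (F \o (G \o j))}.
  exact: (@continuous_comp _ _ _ (G \o j) F q cGj (cF _ GV)).
have [M hM] : exists M : nat, `|F (G (j q))| + 1 < M%:R.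
  exists (Num.bound (`|F (G (j q))| + 1)); apply: archi_boundP.
  by rewrite addr_ge0.
exists M.
have nB : \forall q' \near q, B (j q').
  apply: cj; exact: open_nbhs_nbhs.
have := cFG; move/cvgrPdist_lt => /(_ 1 ltr01).
apply: filterS2 nB => q' Bq' hq' Qq'; apply: ltW; apply: le_lt_trans hM.
rewrite -lerBlDl -(GE (j q'))//; last exact: Aq.
by apply: le_trans (lerB_dist _ _) _; rewrite distrC; exact: ltW.
Qed.

End polar_chart.

(** * Local bounds and their gluing *)

Lemma closed_ball_compact (R : realType) n (p : 'rV[R]_n) (e : R) :
  compact [set y | `|p - y| <= e].
Proof.
apply: bounded_closed_compact.
  exists (`|p| + e); split; first exact: num_real.
  move=> M /ltW PM y /= ye; apply: le_trans PM.
  rewrite -lerBlDl; apply: le_trans (lerB_dist _ _) _.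
  by rewrite distrC.
have -> : [set y | `|p - y| <= e] = (fun y => `|p - y|) @^-1` [set t | t <= e] by [].
apply: closed_comp; last exact: closed_le.
move=> y _; apply: continuous_comp; last exact: norm_continuous.
by apply: continuousB => //; exact: cst_continuous.
Qed.

Lemma sphere_compact (R : realType) d : compact (@sphere R d).
Proof.
apply: bounded_closed_compact.
  exists 1; split; first exact: num_real.
  move=> M /ltW M1 w sw; apply: le_trans M1; rewrite -[leRHS]sw; exact: norm_le_enorm.
have -> : @sphere R d = (fun w : 'rV[R]_d => dot w w) @^-1` [set 1].
  apply/seteqP; split => w; rewrite /sphere /= => h.
    by rewrite -enorm_sq h mulr1.
  by rewrite /enorm h sqrtr1.
apply: closed_comp; last exact: closed_eq.
move=> w _.
have oT : open (setT : set 'rV[R]_d) by exact: openT.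
have s i : smooth_open setT ((fun w : 'rV[R]_d => w 0 i) * (fun w => w 0 i)).
  by apply: smoothM => //; exact: (smooth_entry i oT (smooth_id oT)).
exact: smooth_cont (smooth_sum oT s) _.
Qed.

Section local_estimate.
Variables (R : realType) (n d : nat).
Variables (Sigma T U : set 'rV[R]_n) (pi : 'rV[R]_n -> 'rV[R]_n).
Variables (nu : 'I_d -> 'rV[R]_n -> 'rV[R]_n) (r : R).
Hypothesis tb : tube_retraction Sigma T pi.
Hypotheses (oU : open U) (UT : U `<=` T) (r0 : 0 < r).
Local Notation V := (U `\` Sigma).
Local Notation A := (((Sigma `&` U) `*` @sphere R d) `*` `]0, r[).
Hypothesis polar : diffeo A V (polar_map nu) (polar_coords pi nu).
Local Notation rho := (tube_rho pi).
Local Notation omega := (tube_omega pi nu).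

(** Pushing x along its ray to distance r / 2 from Sigma gives a map Th of order
    0, and c is a constant times rho^k (c o Th). The points of W are chosen with
    their feet in a compact subset of the chart, so that Th maps W into a compact
    set: near the boundary of U the frame, and with it c, may be unbounded. *)
Lemma homogeneous_local_bound p : Sigma p -> U p ->
  exists W, [/\ open W, W p, W `<=` U &
    forall D, D `<=` W -> collar Sigma T pi D ->
      forall b k c, smooth_open V c -> homogeneous V pi r k c -> symb_on D rho b k c].
Proof.
move=> Sp Up.
have oV : open V := polar_open tb oU.
have /nbhs_ballP[e /= e0 eU] : nbhs p U by exact: open_nbhs_nbhs.
have e20 : 0 < e / 2 by rewrite divr_gt0.
pose B := [set y | `|p - y| <= e / 2].
have BU : B `<=` U.
  move=> y By; apply: eU; rewrite -ball_normE /ball_ /=; apply: le_lt_trans By _.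
  by rewrite ltr_pdivrMr// ltr_pMr// ltr1n.
pose W := [set x | U x /\ B (pi x)]°.
have Wp : W p.
  have nU : \forall x \near p, U x by exact: open_nbhs_nbhs.
  have := smooth_cont (retraction_smooth tb) (UT Up).
  move/cvgrPdist_lt => /(_ _ e20); rewrite (retraction_id tb Sp).
  by apply: filterS2 nU => x Ux hx; split=> //; exact: ltW.
exists W; split=> //; first exact: open_interior.
  by move=> x /interior_subset[].
move=> D DW co b k c sc hc.
have oD := collar_open co; have rho_gt0 := collar_gt0 tb co.
have rn0 x : D x -> rho x != 0 by move=> Dx; rewrite gt_eqF// rho_gt0.
have DV : D `<=` V.
  by move=> x Dx; split; [have [] := interior_subset (DW x Dx)|exact: collar_off co x Dx].
have r20 : 0 < r / 2 by rewrite divr_gt0.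
have r2r : r / 2 < r by rewrite ltr_pdivrMr// ltr_pMr// ltr1n.
pose Th x := ray pi (r / 2 / rho x) x.
have ThE x : D x -> Th x = polar_map nu (pi x, omega x, r / 2).
  by move=> Dx; rewrite /Th (ray_polar polar _ (DV _ Dx)) divfK ?rn0.
have ThV x : D x -> V (Th x).
  move=> Dx; have [] := polar_ray polar (DV x Dx) (t := r / 2 / rho x) => //.
    by rewrite divr_gt0// rho_gt0.
  by rewrite divfK ?rn0.
pose Q := (Sigma `&` B) `*` @sphere R d.
have cQ : compact Q.
  apply: compact_setX; last exact: sphere_compact.
  rewrite setIC; apply: compact_closedI; first exact: closed_ball_compact.
  exact: retraction_closed tb.
have QS : Q `<=` (Sigma `&` U) `*` @sphere R d.
  by move=> q [[? Bq] ?]; split=> //; split=> //; exact: BU.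
have bd F : smooth_open V F -> isO_on D rho 0 (F \o Th).
  move=> sF; have [M hM] := polar_sphere_bounded r0 polar cQ QS
    (fun x Vx => smooth_cont sF Vx).
  exists M%:R, 1; split=> // x Dx _; rewrite expr0z mulr1 /= ThE//; apply: hM.
  have [Spx _ sw _ _] := polar_mem polar (DV x Dx).
  by split=> //; split=> //; have [] := interior_subset (DW x Dx).
have sz := smooth_rhoV tb co; have hz b' := symb_rhoV tb co b'.
have sT (f : 'rV[R]_n -> R) : smooth_open T f -> smooth_open D f.
  exact: smooth_sub (collar_sub co).
have so j := sT _ (smooth_offset tb j).
have sp j := sT _ (smooth_entry j (retraction_open tb) (retraction_smooth tb)).
have thE j : (fun x => Th x 0 j) = (fun x => pi x 0 j) +
    (fun x => r / 2 * ((fun x => (rho x)^-1) * (fun x => (x - pi x) 0 j)) x).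
  by apply/funext => x; rewrite /Th /ray mxE [X in _ + X]mxE -mulrA.
have sTh j : smooth_open D (fun x => Th x 0 j).
  rewrite thE; apply: smoothD => //; apply: smoothZ => //; exact: smoothM.
have hTh b' j : symb_on D rho b' 0 (fun x => Th x 0 j).
  rewrite thE; apply: symbD => //.
  - by apply: smoothZ => //; exact: smoothM.
  - exact: (symb_smooth tb co b' (smooth_entry j (retraction_open tb) (retraction_smooth tb))).
  - apply: symbZ => //; first exact: smoothM.
    by have := symbM oD rho_gt0 sz (so j) (hz b') (symb_offset tb co b' j); rewrite addNr.
have [s1 h1] := symb_comp tb co oV ThV sTh hTh bd b sc.
have sk := smooth_rhoX tb co k.
have h2 := symbM oD rho_gt0 sk s1 (symb_rhoX tb co b k) h1; rewrite addr0 in h2.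
apply: symb_ext (symbZ oD rho_gt0 ((r / 2) ^ (- k)) (smoothM oD sk s1) h2) => // x Dx.
have E3 : (r / 2) ^ (- k) * (r / 2) ^ k = 1.
  by rewrite -expfzDr ?gt_eqF// addNr expr0z.
have E2 : (r / 2 / rho x) ^ k * rho x ^ k = (r / 2) ^ k.
  by rewrite -expfzMl divfK ?rn0.
have E4 : c (Th x) = (r / 2 / rho x) ^ k * c x.
  by apply: hc; rewrite ?divfK ?rn0 ?divr_gt0 ?rho_gt0//; exact: DV.
have alg (u v z q s : R) : v * q = s -> u * s = 1 -> u * (q * (v * z)) = z.
  by move=> <- us; rewrite -[RHS]mul1r -us; ring.
transitivity ((r / 2) ^ (- k) * (rho x ^ k * c (Th x))); first by [].
rewrite E4; exact: alg E2 E3.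
Qed.

End local_estimate.

Section gluing.
Variables (R : realType) (n : nat).
Variables (Sigma T : set 'rV[R]_n) (pi : 'rV[R]_n -> 'rV[R]_n).
Hypothesis tb : tube_retraction Sigma T pi.
Variables (D Omega K : set 'rV[R]_n).
Hypotheses (co : collar Sigma T pi D) (oOm : open Omega) (cK : compact K).
Hypothesis DOm : D `<=` Omega.
Local Notation rho := (tube_rho pi).

(** Near a point of K off Sigma the estimates are vacuous, and off K the function
    vanishes together with its derivatives. *)
Lemma symb_glue b w (phi : 'rV[R]_n -> R) :
  (forall x, (Omega `\` Sigma) x -> ~ K x -> phi x = 0) ->
  (forall p, K p -> Sigma p -> exists W, [/\ open W, W p &
     symb_on ((W `&` Omega) `\` Sigma) rho b w phi]) ->
  symb_on D rho b w phi.
Proof.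
have rho_gt0 := collar_gt0 tb co.
have DO x : D x -> (Omega `\` Sigma) x.
  by move=> Dx; split; [exact: DOm|exact: collar_off co x Dx].
have base w' (f : 'rV[R]_n -> R) :
    (forall x, (Omega `\` Sigma) x -> ~ K x -> f x = 0) ->
    (forall p, K p -> Sigma p -> exists W, [/\ open W, W p &
      isO_on ((W `&` Omega) `\` Sigma) rho w' f]) ->
    isO_on D rho w' f.
  move=> f0 loc.
  pose P (M : nat) x := D x -> rho x < M.+1%:R^-1 -> `|f x| <= M%:R * rho x ^ w'.
  have pw x : D x -> 0 <= rho x ^ w' by move=> Dx; rewrite exprz_ge0// ltW// rho_gt0.
  have [M hM] : exists M, forall x, K x -> P M x.
    apply: compact_uniform => //.
      move=> M N x MN h Dx xN; apply: le_trans (_ : M%:R * rho x ^ w' <= _).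
        apply: h => //; apply: lt_le_trans xN _.
        by rewrite lef_pV2 ?posrE ?ltr0n// ler_nat.
      by rewrite ler_wpM2r ?pw// ler_nat.
    move=> p Kp; have [Sp|/(away_from_Sigma tb)[M hM]] := pselect (Sigma p).
      have [W [oW Wp [C [e [e0 h]]]]] := loc p Kp Sp.
      have [M1 hM1] : exists M : nat, `|C| < M%:R.
        by exists (Num.bound `|C|); apply: archi_boundP.
      have [M2 hM2] : exists M : nat, M.+1%:R^-1 < e.
        have [M2 _ hM2] := @near_infty_natSinv_lt R (PosNum e0).
        by exists M2; exact: (hM2 M2 (leqnn M2)).
      exists (maxn M1 M2); apply: open_near oW Wp _ => x Wx Dx xM.
      have xe : rho x < e.
        apply: lt_trans hM2; apply: lt_le_trans xM _.
        by rewrite lef_pV2 ?posrE ?ltr0n// ler_nat ltnS leq_maxr.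
      apply: le_trans (h x _ xe) _.
        by split; [split=> //; exact: DOm|exact: collar_off co x Dx].
      rewrite ler_wpM2r ?pw//; apply: le_trans (ler_norm _) _.
      by apply: le_trans (ltW hM1) _; rewrite ler_nat leq_maxl.
    exists M; apply: filterS hM => x hx Dx; rewrite ltNge => /negP; case.
    by apply: hx; exact: collar_sub co x Dx.
  exists M%:R, M.+1%:R^-1; split; first by rewrite invr_gt0 ltr0n.
  move=> x Dx xM; have [Kx|nKx] := pselect (K x); first exact: hM.
  by rewrite f0 ?normr0 ?mulr_ge0 ?pw//; exact: DO.
have cKc : closed K by apply: compact_closed => //; exact: norm_hausdorff.
elim: b w phi => [|b IH] w phi phi0 loc.
  split=> //; apply: base => // p Kp Sp.
  by have [W [oW Wp [h _]]] := loc p Kp Sp; exists W.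
split=> [|i].
  apply: base => // p Kp Sp.
  by have [W [oW Wp [h _]]] := loc p Kp Sp; exists W.
apply: IH.
  move=> x [Ox nSx] nKx.
  have oB : open ((Omega `&` ~` Sigma) `&` ~` K).
    apply: openI; last exact: closed_openC.
    by apply: openI => //; exact/closed_openC/(retraction_closed tb).
  rewrite (partial_ext (g := cst 0) i oB) ?partial_cst//.
  by move=> y [[Oy nSy] nKy]; exact: phi0.
move=> p Kp Sp; have [W [oW Wp [_ h]]] := loc p Kp Sp.
by exists W; split=> //; exact: h.
Qed.

End gluing.

(** * Expansion of a partial derivative in a chart *)

Section chart_step.
Variables (R : realType) (n d : nat).
Variables (Sigma T U : set 'rV[R]_n) (pi : 'rV[R]_n -> 'rV[R]_n).
Variables (nu : 'I_d -> 'rV[R]_n -> 'rV[R]_n) (r : R).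
Hypothesis tb : tube_retraction Sigma T pi.
Hypotheses (oU : open U) (UT : U `<=` T) (r0 : 0 < r).
Local Notation V := (U `\` Sigma).
Local Notation A := (((Sigma `&` U) `*` @sphere R d) `*` `]0, r[).
Hypothesis polar : diffeo A V (polar_map nu) (polar_coords pi nu).
Local Notation rho := (tube_rho pi).
Variable D : set 'rV[R]_n.
Hypotheses (co : collar Sigma T pi D) (DV : D `<=` V).
Local Notation symb := (symb_on D rho).
Let ch := chart_radial tb oU UT polar.
Let oV := radial_open ch.
Let oT := retraction_open tb.
Let oD := collar_open co.
Let rho_gt0 := collar_gt0 tb co.

(** The remainder in [grad_telescope]. *)
Definition grad_tail (c : 'rV[R]_n -> R) (L : nat) x : 'cV[R]_n :=
  iter L (mulmx (Jac1 pi x)) (Jac0 pi x *m grad c x).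

Lemma smooth_Jac0 i j : smooth_open T (fun x => Jac0 pi x i j).
Proof. exact: (smooth_pi_comp tb (smooth_Jac ch i j)). Qed.

Let Jac1E i j : (fun x => Jac1 pi x i j) = (fun x => \sum_(k < n)
  ((fun x => (x - pi x) 0 k) * (partial k (fun y => Jac pi y i j) \o pi)) x).
Proof. by apply/funext => x; rewrite mxE. Qed.

Let sJ1 i j k : smooth_open T
  ((fun x => (x - pi x) 0 k) * (partial k (fun y => Jac pi y i j) \o pi)).
Proof.
apply: smoothM => //; first exact: (smooth_offset tb k).
exact: (smooth_pi_comp tb (smooth_partial k oT (smooth_Jac ch i j))).
Qed.

Lemma smooth_Jac1 i j : smooth_open T (fun x => Jac1 pi x i j).
Proof. by rewrite Jac1E; exact: (smooth_sum oT (sJ1 i j)). Qed.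

Lemma symb_Jac1 b i j : symb b 1 (fun x => Jac1 pi x i j).
Proof.
rewrite Jac1E; apply: (symb_sum oD) => k.
  exact: smooth_sub (collar_sub co) (sJ1 i j k).
have s := smooth_pi_comp tb (smooth_partial k oT (smooth_Jac ch i j)).
have h := symb_smooth tb co b s.
have sT (f : 'rV[R]_n -> R) : smooth_open T f -> smooth_open D f.
  exact: smooth_sub (collar_sub co).
have := symbM oD rho_gt0 (sT _ (smooth_offset tb k)) (sT _ s) (symb_offset tb co b k) h.
by rewrite addr0.
Qed.

Lemma smooth_grad_tail (O : set 'rV[R]_n) c L i : open O -> O `<=` T ->
  smooth_open O c -> smooth_open O (fun x => grad_tail c L x i 0).
Proof.
move=> oO OT sc; elim: L i => [|L IH] i.
  have st j : smooth_open O ((fun x => Jac0 pi x i j) * partial j c).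
    apply: smoothM => //; last exact: smooth_partial.
    exact: smooth_sub OT (smooth_Jac0 i j).
  apply: smooth_ext (smooth_sum oO st) => // x _.
  by rewrite [RHS]mxE; apply: eq_bigr => j _; rewrite [grad c x j 0]mxE.
have st j : smooth_open O ((fun x => Jac1 pi x i j) * (fun x => grad_tail c L x j 0)).
  apply: smoothM => //.
  exact: smooth_sub OT (smooth_Jac1 i j).
apply: smooth_ext (smooth_sum oO st) => // x _.
by rewrite [RHS]mxE.
Qed.

Lemma symb_grad_tail b w c L i : smooth_open D c -> symb b.+1 w c ->
  symb b (w - 1 + L%:Z) (fun x => grad_tail c L x i 0).
Proof.
move=> sc [_ hc]; have DT := collar_sub co.
have sT (f : 'rV[R]_n -> R) : smooth_open T f -> smooth_open D f by exact: smooth_sub.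
elim: L i => [|L IH] i.
  have s0 j := sT _ (smooth_Jac0 i j).
  have st j := smoothM oD (s0 j) (smooth_partial j oD sc).
  suff h j : symb b (w - 1 + 0) ((fun x => Jac0 pi x i j) * partial j c).
    apply: symb_ext (symb_sum oD st h) => // x _.
    by rewrite [RHS]mxE; apply: eq_bigr => j _; rewrite [grad c x j 0]mxE.
  have h0 := symb_smooth tb co b (smooth_Jac0 i j).
  have := symbM oD rho_gt0 (s0 j) (smooth_partial j oD sc) h0 (hc j).
  by rewrite add0r addr0.
have s1 j := sT _ (smooth_Jac1 i j).
have sL j := smooth_grad_tail L j oD DT sc.
have st j := smoothM oD (s1 j) (sL j).
suff h j : symb b (w - 1 + L.+1%:Z) ((fun x => Jac1 pi x i j) * (fun x => grad_tail c L x j 0)).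
  by apply: symb_ext (symb_sum oD st h) => // x _; rewrite [RHS]mxE.
have := symbM oD rho_gt0 (s1 j) (sL j) (symb_Jac1 b i j) (IH j).
by rewrite (_ : 1 + (w - 1 + L%:Z) = w - 1 + L.+1%:Z)//; lia.
Qed.

Lemma grad_partE c l x : grad_part pi c l x =
  (if l is l'.+1 then grad_tail c l' x else grad c x) - grad_tail c l x.
Proof.
case: l => [//|l].
have := grad_telescope pi c l.+1 x; rewrite {1}(grad_telescope pi c l x).
rewrite [in RHS]big_ord_recr -[RHS]addrA => E.
have {}E := addrI _ E.
by rewrite /grad_tail E [RHS]addrK.
Qed.

Lemma smooth_grad_part c l i : smooth_open V c ->
  smooth_open V (fun x => grad_part pi c l x i 0).
Proof.
move=> sc; have VT := radial_sub ch.
have st L := smooth_grad_tail L i oV VT sc.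
have s0 : smooth_open V (fun x => grad c x i 0).
  by apply: smooth_ext (smooth_partial i oV sc) => // x _; rewrite mxE.
case: l => [|l].
  apply: smooth_ext (smoothB oV s0 (st 0%N)) => // x _.
  by rewrite grad_partE [RHS]mxE [X in _ = _ + X]mxE.
apply: smooth_ext (smoothB oV (st l) (st l.+1)) => // x _.
by rewrite grad_partE [RHS]mxE [X in _ = _ + X]mxE.
Qed.

(** The coefficient of order p of the expansion of the i-th partial derivative
    of a sum of homogeneous terms, relative to its leading order. *)
Definition partial_term (c : nat -> 'rV[R]_n -> R) (i : 'I_n) (p : nat) x : R :=
  \sum_(k < p.+1) grad_part pi (c k) (p - k) x i 0.

Lemma partial_term_regroup c i N x :
  \sum_(p < N) partial_term c i p x + \sum_(k < N) grad_tail (c k) (N.-1 - k) x i 0 =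
  \sum_(k < N) partial i (c k) x.
Proof.
elim: N => [|N IH]; first by rewrite !big_ord0 addr0.
rewrite [RHS]big_ord_recr /= -IH [in LHS]big_ord_recr /= -!addrA; congr (_ + _).
rewrite /partial_term -big_split big_ord_recr /=; congr (_ + _).
  apply: eq_bigr => k _; rewrite grad_partE.
  have -> : (N - k = (N.-1 - k).+1)%N by have := ltn_ord k; lia.
  by rewrite [X in X + _]mxE [X in _ + X + _]mxE subrK.
rewrite subnn grad_partE [X in X + _]mxE [X in _ + X + _]mxE subrK.
by rewrite mxE.
Qed.

Lemma homogeneous_partial_term (m : int) c i p :
  (forall k, smooth_open V (c k)) ->
  (forall k : nat, homogeneous V pi r (m + k%:Z) (c k)) ->
  smooth_open V (partial_term c i p) /\
  homogeneous V pi r (m - 1 + p%:Z) (partial_term c i p).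
Proof.
move=> sc hc; split.
  by apply: (smooth_sum oV) => k; exact: smooth_grad_part.
move=> x t Vx t0 tr; rewrite /partial_term mulr_sumr; apply: eq_bigr => k _.
have E := grad_part_homogeneous ch (p - k) i (sc k) (hc k) Vx t0 tr.
apply: (etrans E); congr (t ^ _ * _).
have kp := ltn_ord k; clear - kp; lia.
Qed.

Variables (m : int) (phi : 'rV[R]_n -> R) (a : int -> 'rV[R]_n * 'rV[R]_d -> R).
Hypotheses (sphi : smooth_open D phi) (hphi : forall b, symb b m phi).
Hypothesis sa : forall j, m <= j -> smooth_on ((Sigma `&` U) `*` @sphere R d) (a j).
Hypothesis exp_phi :
  strong_expansion D rho m phi (fun j => polar_term pi nu (a j) j).
Let c (k : nat) := polar_term pi nu (a (m + k%:Z)) (m + k%:Z).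

Let sc k : smooth_open V (c k).
Proof. by apply: smooth_polar_term tb oU polar _ _ (sa _); lia. Qed.

Let scD k : smooth_open D (c k).
Proof. exact: smooth_sub (sc k). Qed.

Let hc k : homogeneous V pi r (m + k%:Z) (c k).
Proof. exact: homogeneous_polar_term polar _ _. Qed.

(** A term is the difference of two consecutive remainders. *)
Lemma late_terms b q : exists N1 : nat, forall k, (N1 <= k)%N -> symb b q (c k).
Proof.
have [N0 h] := strong_expansion_symb oD b q sphi scD exp_phi.
exists N0 => k Nk; have h1 := h k Nk; have h2 := h k.+1 (leqW Nk).
have sR N : smooth_open D (fun x => phi x - \sum_(k < N) c k x).
  apply: (smoothB oD sphi); exact: smooth_sum.
apply: symb_ext (symbB oD rho_gt0 (sR k) (sR k.+1) h1 h2) => // x _.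
transitivity ((phi x - \sum_(k < k) c k x) - (phi x - \sum_(k < k.+1) c k x)); first by [].
rewrite big_ord_recr /=; move: (phi x) (\sum_(k < k) c k x) (c k x) => u v w; ring.
Qed.

(** The terms need not be bounded near the boundary of the chart by their
    definition; their order is deduced from that of phi. From some rank N1 on they
    are small by [late_terms]. The N1 first ones are separated by Euler fields,
    which costs N1 derivatives: the expansion is then used at a later rank N2,
    where it controls b + N1 derivatives, and the terms between N1 and N2 are the
    ones that [separate_degrees] carries along for free. *)
Lemma terms_order b k : symb b m (c k).
Proof.
have [N1 late] := late_terms b m.
have [kN|/late //] := ltnP k N1.
have [N0 h] := strong_expansion_symb oD (b + N1) m sphi scD exp_phi.
pose N2 := maxn N0 N1.
have sS : smooth_open D (fun x => \sum_(j < N2) c j x) by exact: smooth_sum.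
have hS : symb (b + N1) m (fun x => \sum_(j < N2) c j x).
  have := symbB oD rho_gt0 sphi (smoothB oD sphi sS) (hphi _) (h N2 (leq_maxl _ _)).
  apply: symb_ext => // x _; exact: subKr.
have Ec j x : D x -> euler pi (c j) x = (m + j%:Z)%:~R * c j x.
  move=> Dx; have E := homogeneous_euler ch (sc j) (hc j) (DV Dx).
  exact: E.
apply: (separate_degrees tb co (s := iota 0 N1) (t := iota N1 (N2 - N1)) (iota_uniq _ _) scD Ec).
- by move=> j; rewrite mem_iota => /andP[/late].
- rewrite size_iota; apply: symb_ext hS => // x _.
  rewrite -iotaD subnKC ?leq_maxr//.
  by rewrite -(big_mkord xpredT (fun j => c j x)) /index_iota subn0.
- by rewrite mem_iota.
Qed.

(** By [partial_term_regroup] the remainder is the derivative of the remainder of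
    phi plus the tails of the gradients of the terms. *)
Lemma chart_expansion_partial i : exists a' : int -> 'rV[R]_n * 'rV[R]_d -> R,
  (forall j, m - 1 <= j -> smooth_on ((Sigma `&` U) `*` @sphere R d) (a' j)) /\
  strong_expansion D rho (m - 1) (partial i phi) (fun j => polar_term pi nu (a' j) j).
Proof.
have /choice[ap hap] : forall p : nat, exists u,
    smooth_on ((Sigma `&` U) `*` @sphere R d) u /\
    forall x, V x -> partial_term c i p x = polar_term pi nu u (m - 1 + p%:Z) x.
  move=> p; have [s h] := homogeneous_partial_term i p sc (@hc).
  by have [u] := homogeneous_polar tb oU r0 polar s h; exists u.
pose a' (j : int) := ap (absz (j - (m - 1))%R).
have a'E p : a' (m - 1 + p%:Z) = ap p by rewrite /a' addrAC subrr add0r.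
exists a'; split; first by move=> j _; have [] := hap (absz (j - (m - 1))%R).
have sp := smooth_partial i oD sphi.
have sterm p : smooth_open D (polar_term pi nu (a' (m - 1 + p%:Z)) (m - 1 + p%:Z)).
  rewrite a'E; apply: (smooth_sub DV); apply: smooth_polar_term tb oU polar _ _ _.
  by have [] := hap p.
apply: (symb_strong_expansion oD sp sterm) => b q.
have exp_i := strong_expansion_partial oD i sphi scD exp_phi.
have [N0 h0] := strong_expansion_symb oD b q sp (fun k => smooth_partial i oD (scD k)) exp_i.
have [N1 late] := late_terms b.+1 (q + 1).
(* The tail of a late term is small because the term is; the tail of an early
   one has at least M0 factors Jac1, each gaining one power of rho. *)
pose M0 := absz (q - m + 1)%R.
exists (maxn N0 (N1 + M0 + 1))%N => N; rewrite geq_max => /andP[/h0 {}h0 NN].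
have DT := collar_sub co.
have stail (k : 'I_N) := smooth_grad_tail (N.-1 - k) i oD DT (scD k).
have htail (k : 'I_N) : symb b q (fun x => grad_tail (c k) (N.-1 - k) x i 0).
  have [kN|Nk] := ltnP k N1.
    apply: (symb_le rho_gt0) (symb_grad_tail _ i (scD k) (terms_order b.+1 k)).
    lia.
  apply: (symb_le rho_gt0) (symb_grad_tail _ i (scD k) (late k Nk)).
  lia.
have sS : smooth_open D (fun x => \sum_(k < N) partial i (c k) x).
  by apply: (smooth_sum oD) => k; exact: smooth_partial.
have := symbD oD (smoothB oD sp sS) (smooth_sum oD stail) h0 (symb_sum oD stail htail).
apply: symb_ext => // x Dx.
have -> : \sum_(k < N) polar_term pi nu (a' (m - 1 + k%:Z)) (m - 1 + k%:Z) x =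
    \sum_(k < N) partial_term c i k x.
  apply: eq_bigr => k _; rewrite a'E; have [_ ->] := hap k => //; exact: DV.
transitivity (partial i phi x - \sum_(k < N) partial i (c k) x +
  \sum_(k < N) grad_tail (c k) (N.-1 - k) x i 0); first by [].
rewrite -partial_term_regroup opprD addrA.
exact: subrK.
Qed.

End chart_step.

(** * Thick test functions *)

Lemma symb_empty (R : realType) n (D : set 'rV[R]_n) rho b w f :
  (forall x, ~ D x) -> symb_on D rho b w f.
Proof.
move=> D0; have O0 w' g : isO_on D rho w' g by exists 0, 1; split=> // x /D0.
by elim: b w f => [|b IH] w f; split.
Qed.

Section thick_tests.
Variables (R : realType) (n d : nat) (Sigma : set 'rV[R]_n).
Variables (eps : 'rV[R]_n -> R) (pi : 'rV[R]_n -> 'rV[R]_n).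
Variables (U : nat -> set 'rV[R]_n) (nu : nat -> 'I_d -> 'rV[R]_n -> 'rV[R]_n).
Hypotheses (Sigma_mfd : closed_submanifold d Sigma)
  (Sigma_tube : tubular_nbhd Sigma eps pi)
  (Sigma_cover : adapted_cover Sigma eps pi U nu).
Local Notation T := (\bigcup_l U l).
Local Notation rho := (tube_rho pi).

Lemma cover_retraction : tube_retraction Sigma T pi.
Proof.
have [_ cS _] := Sigma_mfd; have [ST hU] := Sigma_cover.
have [_ _ clos spi _] := Sigma_tube.
have Utube x : T x -> tube Sigma eps x.
  by move=> [l _ Ux]; have [_ _ + _] := hU l; exact.
split=> //.
- by apply: bigcup_open => l _; have [] := hU l.
- exact: smooth_sub spi.
- by move=> x /Utube/clos[].
- move=> x Sx; apply: contrapT => /nesym nx.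
  have [_ /(_ x Sx nx)] := clos x (Utube x (ST x Sx)).
  rewrite subrr -(scale0r (0 : 'rV[R]_n)) enormZ// mul0r ltNge.
  by rewrite enorm_ge0.
Qed.

Lemma chart_data l : exists r : R, [/\ 0 < r, open (U l), U l `<=` T, bounded_set (U l) &
  diffeo (((Sigma `&` U l) `*` @sphere R d) `*` `]0, r[) (U l `\` Sigma)
    (polar_map (nu l)) (polar_coords pi (nu l))].
Proof.
have [_ /(_ l)[oU bU _ [_ _ [r r0 h]]]] := Sigma_cover.
by exists r; split=> // x Ux; exists l.
Qed.

Lemma chart_collar l D : open D -> D `<=` U l `\` Sigma -> collar Sigma T pi D.
Proof.
move=> oD DV; have [r [r0 oU UT bU polar]] := chart_data l.
split=> //.
- by move=> x /DV[/UT].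
- by move=> x /DV[].
- have [M [_ hM]] := bU.
  exists [set y | `|0 - y| <= M + 1]; first exact: closed_ball_compact.
  move=> x /DV[Ux _]; rewrite /= sub0r normrN; apply: hM => //.
  by rewrite ltrDl.
- exact: smooth_sub DV (smooth_rho_chart cover_retraction oU polar).
Qed.

Variables (Omega K : set 'rV[R]_n).
Hypotheses (oOm : open Omega) (cK : compact K).

(** Near a point of K on Sigma the bound comes from the expansion in a chart that
    contains the point, which may differ from the chart l whose boundary is being
    approached. *)
Lemma thick_test_order m phi l : thick_test Sigma pi U nu Omega K m phi ->
  forall b, symb_on ((Omega `&` U l) `\` Sigma) rho b m phi.
Proof.
move=> [sphi phi0 exp] b; have tb := cover_retraction.
have cS := retraction_closed tb.
have openDS B : open B -> open (B `\` Sigma).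
  by move=> oB; rewrite setDE; apply: openI => //; exact: closed_openC.
have [r [r0 oU UT _ polar]] := chart_data l.
have co : collar Sigma T pi ((Omega `&` U l) `\` Sigma).
  by apply: (@chart_collar l) => [|x [[]]//]; exact/openDS/openI.
apply: (symb_glue tb co oOm cK) => //; first by move=> x [[]].
move=> p Kp Sp; have [l1 _ Up] := retraction_sub tb Sp.
have [r1 [r10 oU1 UT1 _ polar1]] := chart_data l1.
have [W [oW Wp WU hW]] := homogeneous_local_bound tb oU1 UT1 r10 polar1 Sp Up.
exists W; split=> //.
pose D := (W `&` Omega) `\` Sigma.
have oD : open D by exact/openDS/openI.
have DV : D `<=` U l1 `\` Sigma by move=> x [[/WU Ux _] nS].
have co1 : collar Sigma T pi D := chart_collar oD DV.
have DD : D `<=` (Omega `&` U l1) `\` Sigma by move=> x [[/WU Ux Ox] nS].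
have [ne|emp] := pselect ((Omega `&` U l1) `\` Sigma !=set0); last first.
  by apply: symb_empty => x /DD h; apply: emp; exists x.
have [a [sa exp_a]] := exp l1 ne.
pose c (k : nat) := polar_term pi (nu l1) (a (m + k%:Z)) (m + k%:Z).
have sc k : smooth_open (U l1 `\` Sigma) (c k).
  by apply: smooth_polar_term tb oU1 polar1 _ _ (sa _ _); lia.
have hc k := homogeneous_polar_term polar1 (a (m + k%:Z)) (m + k%:Z).
have oD1 : open ((Omega `&` U l1) `\` Sigma) by exact/openDS/openI.
have sphi1 : smooth_open ((Omega `&` U l1) `\` Sigma) phi.
  by apply: smooth_sub sphi => x [[]].
have sc1 k : smooth_open ((Omega `&` U l1) `\` Sigma) (c k).
  by apply: smooth_sub (sc k) => x [[]].
have [N h] := strong_expansion_symb oD1 b m sphi1 sc1 exp_a.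
have hR := symb_sub DD (h N (leqnn N)).
have scD k : smooth_open D (c k) := smooth_sub DV (sc k).
have sphiD : smooth_open D phi := smooth_sub DD sphi1.
have hk (k : 'I_N) : symb_on D rho b m (c k).
  apply: (symb_le (collar_gt0 tb co1)) (hW D _ co1 b _ _ (sc k) (hc k)); first lia.
  by move=> x [[]].
have scN (k : 'I_N) := scD k.
have sS := smooth_sum oD scN.
apply: symb_ext (symbD oD (smoothB oD sphiD sS) sS hR (symb_sum oD scN hk)) => // x _.
exact: subrK.
Qed.

Lemma thick_test_partial m phi i : thick_test Sigma pi U nu Omega K m phi ->
  thick_test Sigma pi U nu Omega K (m - 1) (partial i phi).
Proof.
move=> tphi; have ord := thick_test_order _ tphi; have [sphi phi0 exp] := tphi.
have tb := cover_retraction; have cS := retraction_closed tb.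
have openDS B : open B -> open (B `\` Sigma).
  by move=> oB; rewrite setDE; apply: openI => //; exact: closed_openC.
have cKc : closed K by apply: compact_closed => //; exact: norm_hausdorff.
split.
- by apply: smooth_partial => //; exact: openDS.
- move=> x Ox nKx.
  have oB : open ((Omega `\` Sigma) `&` ~` K).
    by apply: openI; [exact: openDS|exact: closed_openC].
  rewrite (partial_ext (g := cst 0) i oB) ?partial_cst//.
  by move=> y [Oy nKy]; exact: phi0.
- move=> l ne; have [a [sa exp_a]] := exp l ne.
  have [r [r0 oU UT _ polar]] := chart_data l.
  have oD : open ((Omega `&` U l) `\` Sigma) by exact/openDS/openI.
  have DV : (Omega `&` U l) `\` Sigma `<=` U l `\` Sigma by move=> x [[]].
  have co := chart_collar oD DV.
  have sD : smooth_open ((Omega `&` U l) `\` Sigma) phi.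
    by apply: smooth_sub sphi => x [[]].
  exact: (chart_expansion_partial tb oU UT r0 polar co DV sD (ord l) sa exp_a i).
Qed.

Lemma thick_test_dpartial m alpha phi : thick_test Sigma pi U nu Omega K m phi ->
  thick_test Sigma pi U nu Omega K (m - (mdeg alpha)%:Z) (dpartial alpha phi).
Proof.
move=> tphi.
have iterP i k m' f : thick_test Sigma pi U nu Omega K m' f ->
    thick_test Sigma pi U nu Omega K (m' - k%:Z) (iter k (@partial R n i) f).
  move=> tf; elim: k => [|k IH]; first by rewrite subr0.
  have -> : m' - k.+1%:Z = m' - k%:Z - 1 by lia.
  exact: thick_test_partial.
rewrite /mdeg /dpartial -big_enum /=.
elim: (enum 'I_n) => [|i s IH] /=; first by rewrite big_nil subr0.
rewrite big_cons.
have -> : m - (alpha i + \sum_(j <- s) alpha j)%N%:Z =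
  m - (\sum_(j <- s) alpha j)%N%:Z - (alpha i)%:Z by lia.
exact: iterP.
Qed.

End thick_tests.

Unset Implicit Arguments.

Theorem proposition3p3 (R : realType) (n d : nat) (Sigma : set 'rV[R]_n)
  (eps : 'rV[R]_n -> R) (pi : 'rV[R]_n -> 'rV[R]_n)
  (U : nat -> set 'rV[R]_n) (nu : nat -> 'I_d -> 'rV[R]_n -> 'rV[R]_n)
  (d_gt0 : (1 <= d)%N)
  (Sigma_mfd : closed_submanifold d Sigma)
  (Sigma_tube : tubular_nbhd Sigma eps pi)
  (Sigma_cover : adapted_cover Sigma eps pi U nu)
  (Omega : set 'rV[R]_n) (Omega_open : open Omega)
  (Omega_Sigma : Omega `&` Sigma !=set0)
  (K : set 'rV[R]_n) (K_compact : compact K) (K_Omega : K `<=` Omega°)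
  (m : int) (alpha : 'I_n -> nat) (phi : 'rV[R]_n -> R) :
  thick_test Sigma pi U nu Omega K m phi ->
  thick_test Sigma pi U nu Omega K (m - (mdeg alpha)%:Z) (dpartial alpha phi).
Proof.
exact: (thick_test_dpartial Sigma_mfd Sigma_tube Sigma_cover Omega_open K_compact).
Qed.
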